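(* Let $P_1,P_2,P_3\in\mathbb{R}^2$ be three non-aligned points. The following are equivalent: (i) the set of points $Q\in\mathbb{R}^2$ such that $d(Q,P_1),d(Q,P_2),d(Q,P_3)$ are all rational numbers is dense in $\mathbb{R}^2$ (for the real topology); (ii) the quadratic form $(x,y)\mapsto \|x\,\overrightarrow{P_1P_3}+y\,\overrightarrow{P_2P_3}\|^2$ has rational coefficients and represents a square, i.e. there exist $x,y\in\mathbb{Q}$, not both zero, such that $\|x\,\overrightarrow{P_1P_3}+y\,\overrightarrow{P_2P_3}\|^2$ is the square of a rational number; (iii) the squared distances $d(P_i,P_j)^2$, $i,j\in\{1,2,3\}$, are all rational, and there exists at least one point $Q\in\mathbb{R}^2$ having rational distance from each of $P_1,P_2,P_3$.
   Context: $d(P,Q)$ denotes the Euclidean distance in $\mathbb{R}^2$ and $\|\cdot\|$ the Euclidean norm. ''Non-aligned'' means not lying on a common line. *)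

(* Defs.v *)
From mathcomp Require Import all_boot all_order all_algebra.
From mathcomp Require Import all_classical all_reals all_analysis.

Set Implicit Arguments.
Unset Strict Implicit.
Unset Printing Implicit Defensive.

Import Order.TTheory GRing.Theory Num.Theory.
Import numFieldNormedType.Exports.

Local Open Scope classical_set_scope.
Local Open Scope ring_scope.

(* The library norm `|v| on 'rV[R]_n is the sup norm, hence this definition;
   both norms induce the product topology carried by 'rV[R]_n. *)
Definition euclid_norm (R : realType) (v : 'rV[R]_2) : R :=
  Num.sqrt (\sum_(i < 2) v 0 i ^+ 2).

Definition euclid_dist (R : realType) (P Q : 'rV[R]_2) : R := euclid_norm (Q - P).

Definition aligned (R : realType) (P1 P2 P3 : 'rV[R]_2) : Prop :=
  exists A u : 'rV[R]_2, u != 0 /\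
    [set P1; P2; P3] `<=` [set A + t *: u | t in [set: R]].

Definition rational_coefficients (R : realType) (q : R -> R -> R) : Prop :=
  exists a b c : rat, forall x y : R,
    q x y = ratr a * x ^+ 2 + ratr b * (x * y) + ratr c * y ^+ 2.

(* 0 counts as a square; only the trivial pair x = y = 0 is excluded. *)
Definition represents_square (R : realType) (q : R -> R -> R) : Prop :=
  exists x y : rat, (x, y) <> (0, 0) /\
    exists r : rat, q (ratr x) (ratr y) = ratr r ^+ 2.

(* Main.v *)
Require Import Defs.
From mathcomp Require Import all_boot all_order all_algebra.
From mathcomp Require Import all_classical all_reals all_analysis.
From mathcomp Require Import ring lra.

Import Order.TTheory GRing.Theory Num.Theory.
Import numFieldNormedType.Exports.

Local Open Scope classical_set_scope.
Local Open Scope ring_scope.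

(** From (i), the Cayley-Menger relation is a linear system with rational
    coefficients for the Gram matrix, and density makes it nondegenerate.

    For (ii) => (i), a vector of rational norm gives orthogonal rational
    coordinates in which the squared norm is X^2 + D Y^2.  On a line through P3
    with rational unit direction, the points at rational distance from P1 and P2
    are rational points of an elliptic curve.  Alternating the second
    intersections of the line with the ellipse |QP1| + |QP2| = const and with
    the hyperbola |QP1| - |QP2| = const through a point is a translation of this
    curve, so the orbit of the point at infinity consists of rational points.
    In the angle given by integrating dr / (|QP1| |QP2|) the translation is a
    rotation of a circle, so an orbit without short period meets every interval
    of the line.  The orbit depends rationally on the slope of the line, and near
    the direction parallel to P1P2 the rotation angle is small but nonzero; hence
    short periods occur only for finitely many slopes, and those are avoided. *)

(** * The angle along a line *)

(** The obstacle is uniformity: the interval to be met is given, while the slope must still be moved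
    to avoid short periods. So instead of an infinite orbit a finite criterion is used: if N + 1
    times the angle of the interval exceeds the full angle, it suffices that no k <= N + 1 is a
    period. N is fixed from bounds that depend on |P1P3|, |P2P3| and a lower bound [eta] for the
    squared distances of P1 and P2 to the line, hence before the slope. Both moves change the sign
    of dr / (S T), so they are reflections of the circle. The ellipse fixes infinity, the hyperbola
    exchanges it with a point called the pole, and the rotation angle is that of the pole.
    Conditions (ii) and (iii) are linked by the vector from P3 to Q, which is itself a rational
    combination of the sides with rational norm. *)

Lemma continuous_antiderivative (R : realType) (w : R -> R) (b : R) :
  continuous w -> exists F : R -> R, forall x, b < x -> is_derive x 1 F (w x).
Proof.
move=> cw; pose mu := @lebesgue_measure R.
pose F x := (\int[mu]_(t in [set` Interval (BLeft b) (BRight x)]) w t)%R.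
exists F => x bx.
have [] : derivable F x 1 /\ derive1 F x = w x; last first.
  by move=> dF eF; split; [exact: dF|rewrite -derive1E; exact: eF].
apply: (@continuous_FTC1 R w (BLeft b) x (x + 1)).
- by rewrite ltrDl.
- apply: continuous_compact_integrable; first exact: segment_compact.
  exact: continuous_subspaceT.
- by rewrite lte_fin.
- exact: cw.
Qed.

Section LineAngle.
Context {R : realType}.
Implicit Types (al be a c r x y eta : R).

Definition sqdist al a r := r ^+ 2 - 2 * al * r + a.

Lemma sqdistE al a r : sqdist al a r = (r - al) ^+ 2 + (a - al ^+ 2).
Proof. rewrite /sqdist; ring. Qed.

Lemma sqdist_gt0 al a r : al ^+ 2 < a -> 0 < sqdist al a r.
Proof. by move=> h; rewrite sqdistE ltr_wpDl ?sqr_ge0 ?subr_gt0. Qed.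

(** For the symmetric matrix K with rows (1, -al) and (-al, a), Cayley-Hamilton gives tr K <x, K x>
    = det K |x|^2 + |K x|^2, hence the lower bound det / tr. The upper bound is crude. *)
Lemma binary_form_bounds al a s t : al ^+ 2 < a -> s ^+ 2 + t ^+ 2 = 1 ->
  (a - al ^+ 2) / (1 + a) <= s ^+ 2 - 2 * al * (s * t) + a * t ^+ 2 <= 2 + 2 * a.
Proof.
move=> h st; have a0 : 0 < 1 + a by have := sqr_ge0 al; lra.
apply/andP; split.
  rewrite ler_pdivrMr//.
  have h2 : 0 <= (s - al * t) ^+ 2 + (a * t - al * s) ^+ 2.
    by rewrite addr_ge0 ?sqr_ge0.
  have t2 : t ^+ 2 = 1 - s ^+ 2 by lra.
  suff -> : (s ^+ 2 - 2 * al * (s * t) + a * t ^+ 2) * (1 + a) =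
    (a - al ^+ 2) * (s ^+ 2 + t ^+ 2) + ((s - al * t) ^+ 2 + (a * t - al * s) ^+ 2).
    by rewrite st mulr1; lra.
  ring.
have h2 : 0 <= (s + al * t) ^+ 2 by rewrite sqr_ge0.
have h3 : 0 <= (a - al ^+ 2) * t ^+ 2 by rewrite mulr_ge0 ?sqr_ge0 ?subr_ge0 1?ltW.
have s2 : s ^+ 2 <= 1 by have := sqr_ge0 t; lra.
have t2 : t ^+ 2 <= 1 by have := sqr_ge0 s; lra.
have h4 : a * t ^+ 2 <= a * 1 by rewrite ler_wpM2l//; have := sqr_ge0 al; lra.
nra.
Qed.

Lemma atan_cos_sin r : sin (atan r) = r * cos (atan r) /\
  cos (atan r) ^+ 2 = (1 + r ^+ 2)^-1.
Proof.
have c0 : cos (atan r) != 0.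
  by apply/lt0r_neq0/cos_gt0_pihalf; rewrite atan_gtNpi2 atan_ltpi2.
split; first by rewrite -{2}(atanK r) /tan divfK.
by rewrite cos_atan exprVn sqr_sqrtr // addr_ge0 ?sqr_ge0.
Qed.

(** Bounds for |QP1| |QP2| (cos s)^2 at r = tan s. They do not involve [al] and [be], so they
    persist while the line turns about P3. *)
Definition angle_bound_low eta a c := eta / Num.sqrt ((1 + a) * (1 + c)).
Definition angle_bound_up a c := Num.sqrt ((2 + 2 * a) * (2 + 2 * c)).

(** The substitution r = tan s turns dr / (|QP1| |QP2|) into w(s) ds with w continuous and bounded,
    so the total angle [Om] is finite and all estimates reduce to [atan]. *)
Lemma angle_function eta al a be c : 0 < eta ->
  eta <= a - al ^+ 2 -> eta <= c - be ^+ 2 ->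
  let m := angle_bound_low eta a c in let M := angle_bound_up a c in
  exists (G : R -> R) (Om : R),
  [/\ forall r, is_derive r 1 G
        (Num.sqrt (sqdist al a r) * Num.sqrt (sqdist be c r))^-1,
      forall x y, x <= y ->
        (atan y - atan x) / M <= G y - G x <= (atan y - atan x) / m,
      forall r, (atan r + pi / 2) / M <= G r <= (atan r + pi / 2) / m
    & forall r, (pi / 2 - atan r) / M <= Om - G r <= (pi / 2 - atan r) / m].
Proof.
move=> eta0 hf hg m M.
have hf' : al ^+ 2 < a by lra.
have hg' : be ^+ 2 < c by lra.
have a0 : 0 < 1 + a by have := sqr_ge0 al; lra.
have c0 : 0 < 1 + c by have := sqr_ge0 be; lra.
pose form al a (s : R) := sin s ^+ 2 - 2 * al * (sin s * cos s) + a * cos s ^+ 2.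
have sc s : sin s ^+ 2 + cos s ^+ 2 = 1 :> R by rewrite addrC cos2Dsin2.
have bf s := binary_form_bounds _ _ _ _ hf' (sc s).
have bg s := binary_form_bounds _ _ _ _ hg' (sc s).
have f0 s : 0 < form al a s.
  by have /andP[+ _] := bf s; apply: lt_le_trans; rewrite divr_gt0 ?subr_gt0.
have g0 s : 0 < form be c s.
  by have /andP[+ _] := bg s; apply: lt_le_trans; rewrite divr_gt0 ?subr_gt0.
pose w s := (Num.sqrt (form al a s) * Num.sqrt (form be c s))^-1.
have M0 : 0 < M by rewrite sqrtr_gt0; nra.
have m0 : 0 < m by rewrite divr_gt0 ?sqrtr_gt0 ?mulr_gt0.
have wb s : M^-1 <= w s <= m^-1.
  have fg0 : 0 < form al a s * form be c s by rewrite mulr_gt0.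
  have /andP[bf1 bf2] := bf s; have /andP[bg1 bg2] := bg s.
  have Q0 : 0 < Num.sqrt (form al a s * form be c s) by rewrite sqrtr_gt0.
  rewrite /w -(sqrtrM _ (ltW (f0 s))); apply/andP; split; rewrite lef_pV2 ?posrE//.
    by rewrite ler_sqrt; [apply: ler_pM => //; apply: ltW|nra].
  have ac0 : 0 <= (1 + a) * (1 + c) by rewrite mulr_ge0 // ltW.
  rewrite /m /angle_bound_low -[eta]gtr0_norm // -sqrtr_sqr -sqrtrV //.
  rewrite -sqrtrM ?sqr_ge0// ler_sqrt; last exact: ltW.
  apply: (@le_trans _ _ ((a - al ^+ 2) / (1 + a) * ((c - be ^+ 2) / (1 + c)))).
    rewrite mulf_div ler_wpM2r ?invr_ge0 //.
    by rewrite expr2; apply: ler_pM => //; apply: ltW.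
  by apply: ler_pM => //; apply: divr_ge0; rewrite ?subr_ge0; apply: ltW.
have cform al' a' : continuous (form al' a').
  move=> z; apply: cvgD.
    apply: cvgB; first by rewrite expr2; apply: cvgM; exact: continuous_sin.
    apply: cvgM; [exact: cvg_cst|apply: cvgM]; [exact: continuous_sin|exact: continuous_cos].
  by apply: cvgM; [exact: cvg_cst|rewrite expr2; apply: cvgM]; exact: continuous_cos.
have cw : continuous w.
  move=> z; apply: cvgV; first by rewrite mulf_neq0 // gt_eqF // sqrtr_gt0.
  apply: cvgM.
    by apply: (continuous_comp (cform al a z)); exact: sqrt_continuous.
  by apply: (continuous_comp (cform be c z)); exact: sqrt_continuous.
(* The base point lies strictly below -pi/2, so that [F] is differentiable at -pi/2 too, the value
   of s for r at minus infinity. *)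
have [F dF] := continuous_antiderivative _ w (- pi) cw.
have pi0 := @pi_gt0 R.
have Fb x y : - pi < x -> x <= y -> (y - x) / M <= F y - F x <= (y - x) / m.
  move=> px xy.
  have dFz z : z \in `]x, y[ -> is_derive z 1 F (w z).
    by rewrite in_itv/= => /andP[xz _]; apply: dF; apply: lt_trans xz.
  have cF : {within `[x, y], continuous F}.
    apply: derivable_within_continuous => z; rewrite in_itv/= => /andP[xz _].
    by have [] := dF z (lt_le_trans px xz).
  have [z _ ->] := MVT_segment xy dFz cF.
  have /andP[w1 w2] := wb z.
  by rewrite ![(y - x) / _]mulrC !ler_wpM2r ?subr_ge0.
have api r := @atan_gtNpi2 R r.
have bpi r := @atan_ltpi2 R r.
exists (fun r => F (atan r) - F (- (pi / 2))), (F (pi / 2) - F (- (pi / 2))); split.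
- move=> r.
  have -> : (Num.sqrt (sqdist al a r) * Num.sqrt (sqdist be c r))^-1 =
      w (atan r) * (1 + r ^+ 2)^-1 - 0.
    have [sE cE] := atan_cos_sin r.
    have fE al' a' : form al' a' (atan r) = sqdist al' a' r * (1 + r ^+ 2)^-1.
      by rewrite /form sE -cE /sqdist; ring.
    have r0 : 0 < 1 + r ^+ 2 by rewrite ltr_pwDl ?sqr_ge0.
    rewrite subr0 /w !fE !sqrtrM ?ltW ?sqdist_gt0//.
    rewrite mulrACA -expr2 sqr_sqrtr ?invr_ge0 1?ltW//.
    by rewrite [in RHS]invfM invrK -mulrA divff ?mulr1 // gt_eqF.
  have aw : is_derive (atan r) 1 F (w (atan r)).
    by apply: dF; apply: lt_trans (api r); lra.
  exact: is_deriveB.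
- move=> x y xy; rewrite opprB addrA subrK; apply: Fb; last exact: le_atan.
  by apply: lt_trans (api x); lra.
- move=> r; rewrite -[X in atan r + X]opprK; apply: Fb; [lra|exact: ltW].
- move=> r; rewrite opprB addrA subrK; apply: Fb; last exact: ltW.
  by apply: lt_trans (api r); lra.
Qed.

End LineAngle.

(** * Conics with foci P1 and P2 on a line through P3 *)

Section ConicMove.
Context {F : fieldType}.
Implicit Types (al be a c : F) (s : F * F * F).

(* A state (r, S, T) is the point at abscissa r on the line through P3, with
   signed distances S to P1 and T to P2; al and be are the abscissae of the
   projections of P1 and P2 on the line, a and c their squared distances to P3.
   [conic_move] is the second intersection of the line with the conic where
   S - T is constant, computed by Vieta; on that conic both S and T are affine
   in r with slope (be - al) / (S - T).  For S T < 0 the conic is an ellipse. *)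
Definition conic_den al be s := (be - al) ^+ 2 - (s.1.2 - s.2) ^+ 2.
Definition conic_num al be s := s.1.2 * (s.1.1 - be) - s.2 * (s.1.1 - al).
Definition conic_ratio al be s := 2 * conic_num al be s / conic_den al be s.

Definition conic_move al be s :=
  let k := conic_ratio al be s in
  (s.1.1 + (s.1.2 - s.2) * k, s.1.2 + (be - al) * k, s.2 + (be - al) * k).

Definition flip s := (s.1, - s.2).

(** Conjugation by [flip] keeps S + T constant instead of S - T. From a state with S T > 0,
    [half_step] therefore uses the ellipse and the outer move of [step] the hyperbola. *)
Definition half_step al be s := flip (conic_move al be (flip s)).

Definition step al be s := conic_move al be (half_step al be s).

(** If S - T = be - al, division of S^2 - T^2 = 2 (be - al) r + a - c by S - T gives S + T, and then
    S = r + kappa. *)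
Definition kappa al be a c := ((be - al) ^+ 2 + a - c) / (2 * (be - al)).

(* The image of the point at infinity under [conic_move]: there
   S = r + kappa and T = S - (be - al). *)
Definition pole al be a c :=
  (a - kappa al be a c ^+ 2) / (2 * (kappa al be a c + al)).

Definition pole_state al be a c :=
  let p := pole al be a c in let k := kappa al be a c in
  (p, p + k, p + k - (be - al)).

Definition orb al be a c n := iter n (step al be) (pole_state al be a c).

End ConicMove.

Section OnLine.
Context {R : realType}.
Implicit Types (al be a c r x y eta : R) (s : R * R * R).

Definition on_line_curve al be a c s :=
  s.1.2 ^+ 2 = sqdist al a s.1.1 /\ s.2 ^+ 2 = sqdist be c s.1.1.

Lemma flip_on al be a c s :
  on_line_curve al be a c s -> on_line_curve al be a c (flip s).
Proof. by rewrite /on_line_curve /= sqrrN. Qed.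

Lemma conic_move_on al be a c s : conic_den al be s != 0 ->
  on_line_curve al be a c s -> on_line_curve al be a c (conic_move al be s).
Proof.
case: s => [[r S] T] D0 [/= fE gE].
have := divfK D0 (2 * conic_num al be (r, S, T)).
rewrite /on_line_curve /conic_move /=.
rewrite -/(conic_ratio al be (r, S, T)); set k := conic_ratio _ _ _.
rewrite /conic_den /conic_num /= => kE.
rewrite /sqdist in fE gE *.
(* The added term is zero by [kE]; it is exactly what separates the curve equations at the old and
   at the new point. *)
have e1 X : X = X + k * (k * ((be - al) ^+ 2 - (S - T) ^+ 2) - 2 * (S * (r - be) - T * (r - al))).
  by rewrite kE subrr mulr0 addr0.
split; rewrite [RHS]e1.
  transitivity (S ^+ 2 + 2 * S * ((be - al) * k) + ((be - al) * k) ^+ 2); first by ring.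
  rewrite fE; ring.
transitivity (T ^+ 2 + 2 * T * ((be - al) * k) + ((be - al) * k) ^+ 2); first by ring.
rewrite gE; ring.
Qed.

Section Sign.
Variables (al be a c : R).
Hypotheses (ha : al ^+ 2 < a) (hc : be ^+ 2 < c).
Let Th := a + c - 2 * al * be.

(* The two components S T > 0 and S T < 0 of the curve are separated by the
   value of (S - T)^2, which [conic_move] preserves. *)
Lemma conic_sign s : on_line_curve al be a c s ->
  [/\ s.1.2 != 0, s.2 != 0, (0 < s.1.2 * s.2) = ((s.1.2 - s.2) ^+ 2 < Th)
    & (s.1.2 * s.2 < 0) = (Th < (s.1.2 - s.2) ^+ 2)].
Proof.
case: s => [[r S] T] [/= fE gE].
have f0 := sqdist_gt0 _ _ r ha; have g0 := sqdist_gt0 _ _ r hc.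
have S0 : S != 0 by rewrite -sqrf_eq0 fE gt_eqF.
have T0 : T != 0 by rewrite -sqrf_eq0 gE gt_eqF.
have E : (S - T) ^+ 2 - Th = 2 * ((r - al) * (r - be) - S * T).
  transitivity (S ^+ 2 + T ^+ 2 - 2 * S * T - Th); first by ring.
  rewrite fE gE /sqdist /Th; ring.
(* Each distance exceeds its component along the line, so S T dominates in [E] and alone decides its
   sign. *)
have lt2 : ((r - al) * (r - be)) ^+ 2 < (S * T) ^+ 2.
  rewrite !exprMn fE gE !sqdistE.
  have := sqr_ge0 (r - al); have := sqr_ge0 (r - be).
  move: ha hc; rewrite -subr_gt0 -[_ < c]subr_gt0.
  set A := (r - al) ^+ 2; set B := (r - be) ^+ 2; set h := a - _; set h' := c - _.
  move=> *; nra.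
have [h|h] := ltP (S * T) 0.
  have h' := ltW h; have : `|(r - al) * (r - be)| < - (S * T).
    by rewrite -ltr_sqr ?nnegrE ?oppr_ge0 // sqrrN real_normK ?num_real.
  rewrite ltr_norml => /andP[h1 h2].
  by split => //; [apply/idP/idP; lra|apply/esym/idP; lra].
have {}h : 0 < S * T by rewrite lt_def mulf_neq0.
have h' := ltW h; have : `|(r - al) * (r - be)| < S * T.
  by rewrite -ltr_sqr ?nnegrE // real_normK ?num_real.
rewrite ltr_norml => /andP[h1 h2].
split => //; first by rewrite h; apply/esym/idP; lra.
by apply/idP/idP; lra.
Qed.

Lemma Th_gt : (be - al) ^+ 2 < Th.
Proof. by move: ha hc; rewrite /Th !expr2; lra. Qed.

Lemma conic_move_sign s : conic_den al be s != 0 -> on_line_curve al be a c s ->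
  let s' := conic_move al be s in
  ((0 < s'.1.2 * s'.2) = (0 < s.1.2 * s.2)) /\
  ((s'.1.2 * s'.2 < 0) = (s.1.2 * s.2 < 0)).
Proof.
move=> D0 sO s'.
have [_ _ -> ->] := conic_sign _ sO.
have [_ _ -> ->] := conic_sign _ (conic_move_on _ _ _ _ _ D0 sO).
have -> // : s'.1.2 - s'.2 = s.1.2 - s.2.
by rewrite /s' /conic_move /=; ring.
Qed.

(** Here (S - T)^2 exceeds [Th], hence (be - al)^2: an ellipse meets the line at finite points only,
    so the ellipse half of a step is always defined. *)
Lemma conic_den_neg s : on_line_curve al be a c s -> s.1.2 * s.2 < 0 ->
  conic_den al be s < 0.
Proof.
move=> sO; have [_ _ _ ->] := conic_sign _ sO.
by rewrite /conic_den; have := Th_gt; lra.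
Qed.

End Sign.

(** In differential form, dr' / (S' T') = - dr / (S T): the involution negates the invariant
    differential of the elliptic curve. *)
Lemma is_derive_conic_move al be (S T : R -> R) r :
  let st x := (x, S x, T x) in
  S r != 0 -> T r != 0 -> conic_den al be (st r) != 0 ->
  is_derive r 1 S ((r - al) / S r) -> is_derive r 1 T ((r - be) / T r) ->
  let s' := conic_move al be (st r) in
  is_derive r 1 (fun x => (conic_move al be (st x)).1.1)
    (- (s'.1.2 * s'.2) / (S r * T r)).
Proof.
move=> st S0 T0 D0 dS dT s'.
have dD : is_derive r 1 (fun x => conic_den al be (st x))
    (- (2 * (S r - T r) * ((r - al) / S r - (r - be) / T r))).
  rewrite (_ : (fun x => _) = cst ((be - al) ^+ 2) - (S - T) ^+ 2) //.
  apply: is_derive_eq; rewrite /= -[_ *: _]/(_ * _) !fctE; ring.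
have dN : is_derive r 1 (fun x => conic_num al be (st x))
    (S r + (r - be) * ((r - al) / S r) - (T r + (r - al) * ((r - be) / T r))).
  rewrite (_ : (fun x => _) = S * (id - cst be) - T * (id - cst al)) //.
  apply: is_derive_eq; rewrite /= -![_ *: _]/(_ * _) !fctE; ring.
pose N x := conic_num al be (st x); pose V x := (conic_den al be (st x))^-1.
have dV : is_derive r 1 V _ :=
  @is_deriveV R (fun x => conic_den al be (st x)) r _ 1 D0 dD.
rewrite -/(N) in dN.
rewrite (_ : (fun x => _) = id + (S - T) * ((cst 2 * N) * V)) //.
apply: is_derive_eq.
rewrite /= -![_ *: _]/(_ * _) !fctE /s' /conic_move /conic_ratio /N /V /=.
move: D0; rewrite /conic_den /conic_num /=.
move: (S r) (T r) S0 T0 => s t s0 t0 D0.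
field.
by rewrite s0 t0 D0.
Qed.

End OnLine.

(** * The two conic moves as reflections of a circle *)

(** [G] identifies the line, with one point added at infinity, with the circle R / Om Z, infinity
    having angle 0. *)
Definition is_line_angle {R : realType} (al be a c : R) (G : R -> R) (Om : R) :=
  [/\ forall r : R, is_derive r 1 G
        (Num.sqrt (sqdist al a r) * Num.sqrt (sqdist be c r))^-1,
      forall r, 0 < G r < Om,
      forall x y, x < y -> G x < G y,
      forall e, 0 < e -> exists r, G r < e
    & forall e, 0 < e -> exists r, Om - e < G r].

(** Negating S and T together does not change the new abscissa ([conic_move_opp]), so the move acts
    on abscissae once the sign of S T is chosen: -1 for the ellipse, 1 for the hyperbola. *)
Definition reflection {R : realType} (al be a c sg r : R) :=
  (conic_move al be
     (r, Num.sqrt (sqdist al a r), sg * Num.sqrt (sqdist be c r))).1.1.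

Section Dynamics.
Context {R : realType}.
Variables (al be a c : R).
Hypotheses (ha : al ^+ 2 < a) (hc : be ^+ 2 < c).
Implicit Types (r x y : R) (s : R * R * R).

Let S r := Num.sqrt (sqdist al a r).
Let T r := Num.sqrt (sqdist be c r).
Let on := on_line_curve al be a c.

Lemma sqrt_sqdist_gt0 r : 0 < S r /\ 0 < T r.
Proof. by rewrite !sqrtr_gt0 !sqdist_gt0. Qed.

Lemma sqrt_sqdist_on r : on (r, S r, T r).
Proof. by split; rewrite /= sqr_sqrtr // ltW // sqdist_gt0. Qed.

Lemma is_derive_sqrt_sqdist al' a' r : al' ^+ 2 < a' ->
  is_derive r 1 (fun x => Num.sqrt (sqdist al' a' x))
    ((r - al') / Num.sqrt (sqdist al' a' r)).
Proof.
move=> h; have f0 := sqdist_gt0 _ _ r h.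
have df : is_derive r 1 (sqdist al' a') (2 * (r - al')).
  rewrite (_ : sqdist al' a' = id ^+ 2 - cst (2 * al') * id + cst a') //.
  by apply: is_derive_eq; rewrite /= -![_ *: _]/(_ * _) ?fctE /cst /=; ring.
apply: (is_derive_eq (is_derive1_comp (is_derive1_sqrt f0) df)).
rewrite invfM mulrACA; field.
by rewrite sqrtr_eq0 -ltNge.
Qed.

Lemma curve_sqrt s : on s -> 0 < s.1.2 * s.2 ->
  s = (s.1.1, S s.1.1, T s.1.1) \/ s = (s.1.1, - S s.1.1, - T s.1.1).
Proof.
case: s => [[r s] t] [/= fE gE] st0.
rewrite /S /T -fE -gE !sqrtr_sqr.
have [s0|s0] := ltP 0 s.
  have t0 : 0 < t by rewrite -(pmulr_rgt0 _ s0).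
  by left; rewrite !gtr0_norm.
have s1 : s < 0.
  by rewrite lt_def eq_sym s0 andbT; apply/eqP => z; move: st0; rewrite z mul0r ltxx.
have t0 : t < 0 by rewrite -(nmulr_rgt0 _ s1).
by right; rewrite !ltr0_norm // !opprK.
Qed.

Lemma conic_move_opp r (s t : R) :
  (conic_move al be (r, - s, - t)).1.1 = (conic_move al be (r, s, t)).1.1 /\
  conic_den al be (r, - s, - t) = conic_den al be (r, s, t).
Proof.
have e : conic_den al be (r, - s, - t) = conic_den al be (r, s, t).
  by rewrite /conic_den /=; ring.
split=> //; rewrite /conic_move /conic_ratio e /conic_num /=; ring.
Qed.

Variables (G : R -> R) (Om : R).
Hypothesis HG : is_line_angle al be a c G Om.

Let refl := reflection al be a c.

Lemma is_derive_refl sg r : sg ^+ 2 = 1 -> conic_den al be (r, S r, sg * T r) != 0 ->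
  is_derive r 1 (fun x => G (refl sg x) + G x) 0.
Proof.
have [dG _ _ _ _] := HG.
move=> sg1 D0; have [S0 T0] := sqrt_sqdist_gt0 r.
have sg0 : sg != 0 by rewrite -sqrf_eq0 sg1 oner_eq0.
have ST0 : S r * (sg * T r) != 0 by rewrite !mulf_neq0 // gt_eqF.
have sO : on (r, S r, sg * T r).
  by have [e1 e2] := sqrt_sqdist_on r; split => //=; rewrite exprMn sg1 mul1r.
have dS : is_derive r 1 S ((r - al) / S r) by exact: is_derive_sqrt_sqdist.
have dT : is_derive r 1 (fun x => sg * T x) ((r - be) / (sg * T r)).
  have dT' : is_derive r 1 T ((r - be) / T r) by exact: is_derive_sqrt_sqdist.
  apply: (is_derive_eq (@is_deriveZ _ _ _ T sg r 1 _ dT')); rewrite -[_ *: _]/(_ * _).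
  have sgV : sg^-1 = sg by apply: (mulIf sg0); rewrite mulVf // -expr2.
  by rewrite invfM sgV; ring.
have T0' : sg * T r != 0 by rewrite mulf_neq0 // gt_eqF.
have dJ := @is_derive_conic_move R al be S (fun x => sg * T x) r (lt0r_neq0 S0) T0' D0 dS dT.
have sgn := conic_move_sign _ _ _ _ ha hc _ D0 sO.
have [] := conic_move_on _ _ _ _ _ D0 sO.
move=> e1 e2; apply: (is_derive_eq (is_deriveD (is_derive1_comp (dG (refl sg r)) dJ) (dG r))).
rewrite /refl /reflection; move: sgn e1 e2; cbv zeta.
move: (conic_move _ _ _) => s' [sgn1 sgn2] e1 e2.
rewrite {1}/S {1}/T -e1 -e2 !sqrtr_sqr -normrM.
have [p0|n0] := ltP 0 (S r * (sg * T r)).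
  have p1 : 0 < s'.1.2 * s'.2 by rewrite sgn1.
  have sgE : sg = 1.
    have : 0 < sg by move: p0; rewrite pmulr_rgt0 // pmulr_lgt0.
    by move=> h; apply/eqP; rewrite -(@eqrXn2 _ 2) ?ler01 ?ltW // sg1 expr1n.
  have := lt0r_neq0 p1; rewrite mulf_eq0 negb_or => /andP[u0 v0].
  rewrite gtr0_norm // sgE; field.
  by rewrite u0 v0 !gt_eqF.
have {}n0 : S r * (sg * T r) < 0 by rewrite lt_neqAle ST0.
have n1 : s'.1.2 * s'.2 < 0 by rewrite sgn2.
have sgE : sg = -1.
  have : sg < 0 by move: n0; rewrite pmulr_rlt0 // pmulr_llt0.
  move=> h; apply/eqP; rewrite -eqr_opp opprK -(@eqrXn2 _ 2) ?ler01 //.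
    by rewrite sqrrN sg1 expr1n.
  by rewrite oppr_ge0 ltW.
have := ltr0_neq0 n1; rewrite mulf_eq0 negb_or => /andP[u0 v0].
rewrite ltr0_norm // sgE; field.
by rewrite u0 v0 !gt_eqF.
Qed.

Lemma refl_const sg (I : interval R) : sg ^+ 2 = 1 ->
  (forall r, r \in I -> conic_den al be (r, S r, sg * T r) != 0) ->
  forall x y, x \in I -> y \in I -> G (refl sg x) + G x = G (refl sg y) + G y.
Proof.
move=> sg1 D0.
suff H x y : x \in I -> y \in I -> x <= y -> G (refl sg x) + G x = G (refl sg y) + G y.
  move=> x y xI yI; have [xy|/ltW yx] := leP x y; first exact: H.
  by rewrite (H y x).
move=> xI yI xy.
have inI z : z \in `[x, y] -> z \in I.
  by rewrite in_itv /= => zxy; apply: (interval_is_interval xI yI).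
have dH z : z \in `]x, y[ -> is_derive z 1 (fun x => G (refl sg x) + G x) (cst 0 z).
  move=> zxy; apply: is_derive_refl => //; apply: D0; apply: inI.
  by move: zxy; rewrite !in_itv /= => /andP[/ltW -> /ltW ->].
have cH : {within `[x, y], continuous (fun x => G (refl sg x) + G x)}.
  apply: derivable_within_continuous => z zxy.
  by have [] := is_derive_refl sg z sg1 (D0 z (inI z zxy)).
have [z _] := MVT_segment xy dH cH.
by rewrite mul0r => /eqP; rewrite subr_eq0 => /eqP.
Qed.

Lemma refl_minus r : G (refl (-1) r) + G r = Om.
Proof.
have [_ G0 _ Ginf Gsup] := HG.
have D0 x : conic_den al be (x, S x, -1 * T x) != 0.
  have [s0 t0] := sqrt_sqdist_gt0 x.
  apply/ltr0_neq0; rewrite mulN1r.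
  apply: (conic_den_neg _ _ _ _ ha hc); first exact: (flip_on _ _ _ _ _ (sqrt_sqdist_on x)).
  by rewrite /= mulrN oppr_lt0 mulr_gt0.
have cst x : G (refl (-1) x) + G x = G (refl (-1) r) + G r.
  apply: (refl_const _ `]-oo, +oo[); rewrite ?in_itv // sqrrN ?expr1n //.
(* The constant is evaluated where [G] is near 0 for the upper bound and where it is near [Om] for
   the lower bound. *)
apply/eqP; rewrite eq_le; apply/andP; split; apply/ler_addgt0Pl => e e0.
  have [x xe] := Ginf e e0; rewrite -(cst x) addrC lerD //; first exact: ltW.
  by apply: ltW; have /andP[] := G0 (refl (-1) x).
have [x xe] := Gsup e e0; rewrite -(cst x).
by have /andP[+ _] := G0 (refl (-1) x); lra.
Qed.

End Dynamics.

Section Pole.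
Context {R : realType}.
Variables (al be a c : R).
Hypotheses (ha : al ^+ 2 < a) (hc : be ^+ 2 < c).
Implicit Types (r x y : R) (s : R * R * R).

Let S r := Num.sqrt (sqdist al a r).
Let T r := Num.sqrt (sqdist be c r).
Let on := on_line_curve al be a c.

Hypothesis del0 : be - al != 0.
Hypothesis kal0 : kappa al be a c + al != 0.
Let p := pole al be a c.
Let k := kappa al be a c.

Let kE : k * (2 * (be - al)) = (be - al) ^+ 2 + a - c.
Proof. by rewrite /k /kappa divfK // mulf_neq0. Qed.

Let pE : p * (2 * (k + al)) = a - k ^+ 2.
Proof. by rewrite /p /pole divfK // mulf_neq0. Qed.

Lemma pole_state_on : on (pole_state al be a c).
Proof.
rewrite /on /on_line_curve /pole_state /= -/p -/k /sqdist; split.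
  transitivity (p ^+ 2 - 2 * al * p + p * (2 * (k + al)) + k ^+ 2); first by ring.
  by rewrite pE; ring.
transitivity (p ^+ 2 - 2 * be * p + p * (2 * (k + al)) + k ^+ 2 + (be - al) ^+ 2
   - k * (2 * (be - al))); first by ring.
by rewrite pE kE; ring.
Qed.

Lemma pole_state_den : conic_den al be (pole_state al be a c) = 0.
Proof. by rewrite /conic_den /=; ring. Qed.

Lemma pole_state_sign :
  0 < (pole_state al be a c).1.2 * (pole_state al be a c).2.
Proof.
have [_ _ -> _] := conic_sign _ _ _ _ ha hc _ pole_state_on.
by have := Th_gt _ _ _ _ ha hc; have := pole_state_den; rewrite /conic_den; lra.
Qed.

Lemma conic_den_pole : conic_den al be (p, S p, T p) = 0.
Proof.
rewrite -pole_state_den.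
have [->|->] := curve_sqrt _ _ _ _ _ pole_state_on pole_state_sign => //.
by have [_ ->] := conic_move_opp al be p (S p) (T p).
Qed.

(** A vanishing denominator means S - T = be - al or its opposite, so S is r + k or - (r + k). Both
    have the same square and lead to the same linear equation for r. *)
Lemma pole_unique r : conic_den al be (r, S r, T r) = 0 -> r = p.
Proof.
have [fE gE] := sqrt_sqdist_on _ _ _ _ ha hc r.
rewrite /conic_den /= => /eqP; rewrite subr_eq0 eqf_sqr => D0.
move: fE gE; rewrite /= -/(S r) -/(T r) => fE gE.
have fg : (S r - T r) * (S r + T r) = 2 * (be - al) * r + (a - c).
  transitivity (S r ^+ 2 - T r ^+ 2); first by ring.
  by rewrite fE gE /sqdist; ring.
suff SE : S r ^+ 2 = (r + k) ^+ 2.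
  have h : r * (2 * (k + al)) = a - k ^+ 2.
    have := SE; rewrite fE /sqdist => h.
    have -> : r * (2 * (k + al)) = (r + k) ^+ 2 - r ^+ 2 - k ^+ 2 + 2 * al * r by ring.
    by rewrite -h; ring.
  by apply: (mulIf (_ : 2 * (k + al) != 0)); [rewrite mulf_neq0|rewrite h pE].
have d2 : 2 * (be - al) != 0 by rewrite mulf_neq0.
have [/eqP e|/eqP e] := orP D0.
  suff -> : S r = r + k by [].
  apply: (mulfI d2); rewrite [RHS]mulrDr [2 * (be - al) * k]mulrC kE.
  have -> : 2 * (be - al) * S r = (be - al) * (S r + T r) + (be - al) * (S r - T r) by ring.
  by rewrite {1}e fg -e; ring.
suff -> : S r = - (r + k) by rewrite sqrrN.
apply: (mulfI d2); rewrite mulrN [X in _ = - X]mulrDr [2 * (be - al) * k]mulrC kE.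
have -> : 2 * (be - al) * S r = (be - al) * (S r + T r) + (be - al) * (S r - T r) by ring.
have e' : S r - T r = - (be - al) by rewrite e opprK.
by rewrite {1}e mulNr fg e'; ring.
Qed.

(** This makes the image of [p] infinite. A zero numerator, combined with |S - T| = |be - al|, would
    give T^2 = (p - be)^2 and put P2 on the line, against [hc]. *)
Lemma conic_num_pole : conic_num al be (p, S p, T p) != 0 /\ S p - T p != 0.
Proof.
have := conic_den_pole; rewrite /conic_den /= => /eqP; rewrite subr_eq0 => /eqP D0.
have l0 : S p - T p != 0 by rewrite -sqrf_eq0 -D0 sqrf_eq0.
split => //; rewrite /conic_num /=.
have [fE gE] := sqrt_sqdist_on _ _ _ _ ha hc p.
move: fE gE; rewrite /= -/(S p) -/(T p) !sqdistE => fE gE.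
apply/eqP => n0.
have h1 : (be - al) ^+ 2 * ((T p) ^+ 2 - (p - be) ^+ 2) = 0.
  have eqD : (be - al) ^+ 2 = (S p - T p) ^+ 2 by [].
  have nn : S p * (p - be) = T p * (p - al) by apply/eqP; rewrite -subr_eq0 n0.
  transitivity (((be - al) * T p) ^+ 2 - ((be - al) ^+ 2 * (p - be) ^+ 2)); first by ring.
  rewrite eqD.
  transitivity ((T p * (p - al) - T p * (p - be)) ^+ 2 - (S p * (p - be) - T p * (p - be)) ^+ 2).
    ring.
  by rewrite nn subrr.
move/eqP: h1; rewrite mulf_eq0 sqrf_eq0 (negPf del0) /= subr_eq0 gE => /eqP h1.
by move: hc; rewrite -subr_gt0; move: h1; lra.
Qed.

Variables (G : R -> R) (Om : R).
Hypothesis HG : is_line_angle al be a c G Om.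

Let refl := reflection al be a c 1.

(* The reflection sends the pole to infinity, where G tends to 0 or Om. *)
Lemma reflection_near_pole (c0 : R) :
  (forall e, 0 < e -> exists r, [/\ r != p, `|r - p| < e & G (refl r) + G r = c0]) ->
  c0 = G p \/ c0 = G p + Om.
Proof.
have [dG G0 Glt Ginf Gsup] := HG.
move=> near_c0.
have der_cont (h : R -> R) (l : R) : is_derive p 1 h l -> {for p, continuous h}.
  by move=> [dh _]; apply/differentiable_continuous/derivable1_diffP.
have cG : {for p, continuous G} by exact: der_cont (dG p).
have cS : {for p, continuous S} by exact: der_cont (is_derive_sqrt_sqdist _ _ _ ha).
have cT : {for p, continuous T} by exact: der_cont (is_derive_sqrt_sqdist _ _ _ hc).
have cid : {for p, continuous (fun x : R => x)} by exact: cvg_id.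
have ccst (d : R) : {for p, continuous (fun _ : R => d)} by exact: cvg_cst.
have cN : {for p, continuous (fun x => (S x - T x) * (S x * (x - be) - T x * (x - al)))}.
  apply: (continuousM (continuousB cS cT)).
  by apply: continuousB; apply: continuousM => //; exact: continuousB.
have cD : {for p, continuous (fun x => (be - al) ^+ 2 - (S x - T x) * (S x - T x))}.
  apply: (continuousB (ccst _)).
  by apply: continuousM; exact: continuousB.
(* For r other than p, [phi B r > 0] says that [refl r] is farther than B from r; cleared of the
   denominator, it is continuous at p. *)
pose phi B x := `|2 * ((S x - T x) * (S x * (x - be) - T x * (x - al)))|
   - B * `|(be - al) ^+ 2 - (S x - T x) * (S x - T x)|.
have cphi B : {for p, continuous (phi B)}.
  apply: continuousB.
    apply: (@continuous_comp _ _ _ _ (fun x : R => `|x|)); last exact: norm_continuous.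
    exact: (continuousM (ccst _) cN).
  apply: (continuousM (ccst _)).
  by apply: (@continuous_comp _ _ _ _ (fun x : R => `|x|)); last exact: norm_continuous.
have phi0 B : 0 < phi B p.
  have [n0 l0] := conic_num_pole; have := conic_den_pole.
  rewrite /conic_den /conic_num /= expr2 in n0 * => D0.
  by rewrite /phi D0 normr0 mulr0 subr0 normr_gt0 !mulf_neq0.
have H B e : 0 < e -> exists r, [/\ r != p, `|r - p| < 1, `|G r - G p| < e, 0 < phi B r
    & G (refl r) + G r = c0].
  move=> e0.
  have : \forall r \near p, `|r - p| < 1 /\ `|G r - G p| < e /\ 0 < phi B r.
    near=> r; split; last split.
    - by rewrite distrC; near: r; exact: nbhsx_ballx.
    - rewrite distrC; near: r; have /cvgrPdist_lt := cG; exact.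
    - near: r; apply: (cvgr_gt _ (cphi B)); exact: phi0.
  move=> /nbhs_ballP[d /= d0 Hd].
  have [r [rp rd rc]] := near_c0 d d0.
  by exists r; have [|? [? ?]] := Hd r; [rewrite /ball /= distrC|split].
pose z := c0 - G p.
(* Near p, [G (refl r)] is close to z. With z strictly inside, [refl r] would stay between the fixed
   [y1] and [y2], against [phi B r > 0]. *)
suff : ~ (0 < z < Om).
  move=> nz.
  have [z0|z0|z0] := ltgtP z 0.
  - have [r [_ _ + _ rc]] := H 0 (- z) ltac:(lra).
    rewrite ltr_norml => /andP[h1 h2]; have /andP[h3 _] := G0 (refl r); rewrite /z in z0 h1 h2 *; lra.
  - have [z1|z1|z1] := ltgtP z Om.
    + by case: nz; rewrite z0.
    + have [r [_ _ + _ rc]] := H 0 (z - Om) ltac:(lra).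
      rewrite ltr_norml => /andP[h1 h2]; have /andP[_ h3] := G0 (refl r); rewrite /z in z0 h1 h2 *; lra.
    + by right; rewrite -z1 /z; lra.
  - by left; move: z0; rewrite /z; lra.
move=> /andP[z0 z1].
have [y1 y1z] := Ginf z z0.
have [y2 y2z] := Gsup (Om - z) ltac:(lra).
pose B := `|y1| + `|y2| + `|p| + 1.
have [|r [rp r1 rG phir rc]] := H B (Num.min (z - G y1) (G y2 - z)).
  by rewrite lt_min; apply/andP; split; lra.
move: rG; rewrite lt_min !ltr_norml => /andP[/andP[h1 h2] /andP[h3 h4]].
have lt_of x y : G x < G y -> x < y.
  by rewrite [x < y]ltNge; apply: contraTN; rewrite le_eqVlt -leNgt => /predU1P[->//|/Glt/ltW].
have l1 : y1 < refl r by apply: lt_of; move: rc h2; rewrite /z; lra.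
have l2 : refl r < y2 by apply: lt_of; move: rc h3; rewrite /z; lra.
have rB : `|refl r - r| <= B.
  have := ler_norm y2; have := lerNnormlW (lexx `|y1|).
  have := ler_norm p; have := lerNnormlW (lexx `|p|).
  move: r1; rewrite ltr_norml => /andP[? ?].
  have := normr_ge0 y1; have := normr_ge0 y2.
  by rewrite ler_norml /B => *; apply/andP; split; lra.
have D0 : conic_den al be (r, S r, T r) != 0.
  by apply: contraNN rp => /eqP /pole_unique ->.
have E : (refl r - r) * ((be - al) ^+ 2 - (S r - T r) * (S r - T r)) =
   2 * ((S r - T r) * (S r * (r - be) - T r * (r - al))).
  rewrite /refl /reflection mul1r /conic_move /conic_ratio /conic_num /= -/(S r) -/(T r).
  move: D0; rewrite /conic_den /= expr2 => D0; field.
  by rewrite expr2.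
move: phir; rewrite /phi -E normrM subr_gt0 ltNge ler_wpM2r //.
Unshelve. all: by end_near. Qed.

(** The sum is constant on each side of the pole, so r can be replaced by a point on its own side
    arbitrarily close to p. *)
Lemma reflection_plus r : r != p ->
  G (refl r) + G r = G p \/ G (refl r) + G r = G p + Om.
Proof.
move=> rp; apply: reflection_near_pole => e e0.
have D0 x : x != p -> conic_den al be (x, S x, 1 * T x) != 0.
  by rewrite mul1r; apply: contraNN => /eqP /pole_unique ->.
have [rp'|pr|] := ltgtP r p; last by move=> /eqP; rewrite (negPf rp).
  exists (Num.max r (p - e / 2)).
  have mx : Num.max r (p - e / 2) < p by rewrite gt_max rp'; lra.
  split; first by rewrite lt_eqF.
    have : p - e / 2 <= Num.max r (p - e / 2) by rewrite le_max lexx orbT.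
    by rewrite ltr_norml => ?; apply/andP; split; lra.
  apply: (refl_const _ _ _ _ ha hc _ _ HG 1 `]-oo, p[); rewrite ?in_itv //= ?expr1n //.
  by move=> x; rewrite in_itv /= => xp; apply: D0; rewrite lt_eqF.
exists (Num.min r (p + e / 2)).
have mx : p < Num.min r (p + e / 2) by rewrite lt_min pr; lra.
split; first by rewrite gt_eqF.
  have : Num.min r (p + e / 2) <= p + e / 2 by rewrite ge_min lexx orbT.
  by rewrite ltr_norml => ?; apply/andP; split; lra.
apply: (refl_const _ _ _ _ ha hc _ _ HG 1 `]p, +oo[); rewrite ?in_itv /= ?expr1n ?andbT //.
by move=> x; rewrite in_itv /= andbT => xp; apply: D0; rewrite gt_eqF.
Qed.

End Pole.

(** * Rotations without short period *)

Lemma rotation_recurrence (R : realType) (th Om : R) (N : nat) :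
  0 < Om -> (0 < N)%N ->
  exists d z, (0 < d <= N)%N /\ `|d%:R * th - z%:~R * Om| < Om / N%:R.
Proof.
move=> Om0 N0.
pose fl (k : nat) := Num.floor (k%:R * th / Om).
pose fr (k : nat) := k%:R * th / Om - (fl k)%:~R.
have NR : 0 < N%:R :> R by rewrite ltr0n.
have fr01 k : 0 <= fr k < 1.
  by have := floor_itv (k%:R * th / Om); rewrite /fr /fl intrD => /andP[? ?]; apply/andP; split; lra.
have bin_lt k : (Num.truncn (fr k * N%:R) < N)%N.
  have /andP[f0 f1] := fr01 k.
  have fN0 : 0 <= fr k * N%:R by rewrite mulr_ge0 // ltW.
  have /andP[le1 _] := truncn_itv fN0.
  rewrite -(ltr_nat R); apply: le_lt_trans le1 _.
  by rewrite -[ltRHS]mul1r ltr_pM2r.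
pose bin (k : 'I_N.+1) := Ordinal (bin_lt k).
have /injectivePn[k [l kl bkl]] : ~~ injectiveb bin.
  apply/negP => /injectiveP /leq_card; rewrite !card_ord.
  by rewrite ltnn.
wlog ltkl : k l kl bkl / (k < l)%N.
  move=> H; move: (kl); rewrite -val_eqE neq_ltn => /orP[/(H k l kl bkl) //|].
  by apply: H; rewrite 1?eq_sym.
have close : `|fr l - fr k| < N%:R^-1.
  have [/andP[k0 _] /andP[l0 _]] := (fr01 k, fr01 l).
  have /andP[a1 a2] := truncn_itv (mulr_ge0 k0 (ltW NR)).
  have /andP[b1 b2] := truncn_itv (mulr_ge0 l0 (ltW NR)).
  have /(congr1 (fun i : 'I_N => val i)) /= e := bkl.
  rewrite e -natr1 in a1 a2; rewrite -natr1 in b2.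
  rewrite -(ltr_pM2r NR) mulVf ?gt_eqF // -[X in _ * X](gtr0_norm NR) -normrM.
  by rewrite ltr_norml mulrBl; apply/andP; split; lra.
exists (l - k)%N, (fl l - fl k); split.
  by rewrite subn_gt0 ltkl (leq_trans (leq_subr _ _)) // -ltnS.
rewrite natrB 1?ltnW // intrB.
have -> : (l%:R - k%:R) * th - ((fl l)%:~R - (fl k)%:~R) * Om = Om * (fr l - fr k).
  rewrite /fr; field; exact: lt0r_neq0.
by rewrite normrM gtr0_norm // ltr_pM2l.
Qed.

(** By [rotation_recurrence] some d <= N displaces by less than B - A, and by a nonzero amount;
    repeating this displacement cannot jump over the interval. *)
Lemma rotation_hits (R : realType) (th Om A B : R) (N : nat) :
  0 < Om -> (0 < N)%N -> 0 <= A -> B <= Om -> Om < N%:R * (B - A) ->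
  (forall k, (0 < k <= N)%N -> forall z : int, k%:R * th != z%:~R * Om) ->
  exists n (z : int), (0 < n)%N /\ A < n%:R * th - z%:~R * Om < B.
Proof.
move=> Om0 N0 A0 BOm AB irr.
have NR : 0 < N%:R :> R by rewrite ltr0n.
have [d [z [dN close]]] := rotation_recurrence R th Om N Om0 N0.
have e0 : d%:R * th - z%:~R * Om != 0 by rewrite subr_eq0; exact: irr.
move: close; set e := _ - _ in e0 *.
have eE : d%:R * th = z%:~R * Om + e by rewrite /e addrC subrK.
rewrite ltr_pdivlMr // => close.
have eAB : `|e| < B - A by rewrite -(ltr_pM2r NR) [ltRHS]mulrC; apply: lt_trans AB.
have [ep|en] : 0 < e \/ e < 0.
  by move: e0; rewrite neq_lt => /orP[->|->]; [right|left].
- have Ae0 : 0 <= A / e by rewrite divr_ge0 // ltW.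
  have /andP[m1 m2] := truncn_itv Ae0.
  move: m1 m2; set m := Num.truncn _; rewrite -natr1 => m1 m2.
  rewrite ler_pdivlMr // in m1; rewrite ltr_pdivrMr // in m2.
  exists (m.+1 * d)%N, (m.+1%:Z * z); split.
    by rewrite muln_gt0 /=; case/andP: dN.
  rewrite natrM -mulrA eE intrM mulrDr mulrA addrAC subrr add0r -natr1.
  rewrite (gtr0_norm ep) in eAB.
  by rewrite m2 /=; lra.
(* A negative displacement descends from [Om], which is 0 on the circle; hence the [- 1] in the
   number of turns. *)
- have Ae0 : 0 <= (Om - B) / - e by rewrite divr_ge0 ?subr_ge0 // oppr_ge0 ltW.
  have ne : 0 < - e by rewrite oppr_gt0.
  have /andP[m1 m2] := truncn_itv Ae0.
  move: m1 m2; set m := Num.truncn _; rewrite -natr1 => m1 m2.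
  rewrite ler_pdivlMr // in m1; rewrite ltr_pdivrMr // in m2.
  exists (m.+1 * d)%N, (m.+1%:Z * z - 1); split.
    by rewrite muln_gt0 /=; case/andP: dN.
  have mE : (m.+1%:Z)%:~R = m%:R + 1 :> R by rewrite -pmulrn natr1.
  rewrite natrM -mulrA eE intrB intrM mE -natr1.
  by rewrite (ltr0_norm en) in eAB; apply/andP; split; lra.
Qed.

(** The first n steps avoid infinity, which only the hyperbola half can reach. At a zero denominator
    the quotient is 0 by convention and the next state is meaningless. *)
Definition finite_orb {F : fieldType} (al be a c : F) n := forall k, (k < n)%N ->
  conic_den al be (half_step al be (orb al be a c k)) != 0.

Section Orbit.
Context {R : realType}.
Variables (al be a c : R).
Hypotheses (ha : al ^+ 2 < a) (hc : be ^+ 2 < c).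
Let on := on_line_curve al be a c.
Let p := pole al be a c.
Notation orb n := (orb al be a c n).

Lemma half_step_on s : on s -> 0 < s.1.2 * s.2 ->
  on (half_step al be s) /\ 0 < (half_step al be s).1.2 * (half_step al be s).2.
Proof.
move=> sO st.
have fO := flip_on _ _ _ _ _ sO.
have fs : (flip s).1.2 * (flip s).2 < 0 by rewrite /= mulrN oppr_lt0.
have D0 := ltr0_neq0 (conic_den_neg _ _ _ _ ha hc _ fO fs).
split; first by apply: flip_on; exact: conic_move_on.
have [_] := conic_move_sign _ _ _ _ ha hc _ D0 fO.
by cbv zeta; rewrite fs /half_step; case: (conic_move _ _ _) => [[r' s'] t'] /=; rewrite mulrN oppr_gt0.
Qed.

Lemma half_stepE s : on s -> 0 < s.1.2 * s.2 ->
  (half_step al be s).1.1 = reflection al be a c (-1) s.1.1.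
Proof.
move=> sO st; rewrite /half_step /reflection mulN1r.
have [->|->] := curve_sqrt _ _ _ _ _ sO st => //.
have [e _] := conic_move_opp al be s.1.1
  (Num.sqrt (sqdist al a s.1.1)) (- Num.sqrt (sqdist be c s.1.1)).
exact: e.
Qed.

Lemma conic_moveE s : on s -> 0 < s.1.2 * s.2 ->
  (conic_move al be s).1.1 = reflection al be a c 1 s.1.1.
Proof.
move=> sO st; rewrite /reflection mul1r.
have [->|->] := curve_sqrt _ _ _ _ _ sO st => //.
have [e _] := conic_move_opp al be s.1.1
  (Num.sqrt (sqdist al a s.1.1)) (Num.sqrt (sqdist be c s.1.1)).
exact: e.
Qed.

Lemma curve_den s : on s -> 0 < s.1.2 * s.2 ->
  conic_den al be s = conic_den al be
    (s.1.1, Num.sqrt (sqdist al a s.1.1), Num.sqrt (sqdist be c s.1.1)).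
Proof.
move=> sO st; have [{1}->|{1}->] := curve_sqrt _ _ _ _ _ sO st => //.
have [_ e] := conic_move_opp al be s.1.1
  (Num.sqrt (sqdist al a s.1.1)) (Num.sqrt (sqdist be c s.1.1)).
exact: e.
Qed.

Hypothesis del0 : be - al != 0.
Hypothesis kal0 : kappa al be a c + al != 0.

Lemma finite_orb_le n k : (k <= n)%N -> finite_orb al be a c n -> finite_orb al be a c k.
Proof. by move=> kn gn i ik; apply: gn; exact: leq_trans kn. Qed.

Lemma orb_on n : finite_orb al be a c n -> on (orb n) /\ 0 < (orb n).1.2 * (orb n).2.
Proof.
elim: n => [_|n IH gn].
  by split; [exact: pole_state_on|exact: pole_state_sign].
have [sO st] := IH (finite_orb_le _ _ (leqnSn n) gn).
have [mO mt] := half_step_on _ sO st.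
have D0 := gn n (ltnSn n).
split; first exact: conic_move_on.
by have [+ _] := conic_move_sign _ _ _ _ ha hc _ D0 mO; cbv zeta; rewrite mt.
Qed.

Variables (G : R -> R) (Om : R).
Hypothesis HG : is_line_angle al be a c G Om.

(** Modulo [Om] the ellipse sends x to - x and the hyperbola sends x to G p - x, so a step adds G p.
    The factor is n + 1 because the orbit starts at the pole, the image of infinity. *)
Lemma orb_angle n : finite_orb al be a c n ->
  exists z : int, G (orb n).1.1 = n.+1%:R * G p - z%:~R * Om.
Proof.
elim: n => [_|n IH gn]; first by exists 0; rewrite mul0r subr0 mul1r.
have gn' := finite_orb_le _ _ (leqnSn n) gn.
have [z zE] := IH gn'; have [sO st] := orb_on _ gn'.
have [mO mt] := half_step_on _ sO st.
have := refl_minus _ _ _ _ ha hc _ _ HG (orb n).1.1; rewrite -half_stepE // => h1.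
have mp : (half_step al be (orb n)).1.1 != p.
  apply: contraNN (gn n (ltnSn n)) => /eqP e.
  by rewrite curve_den // e conic_den_pole.
have := reflection_plus _ _ _ _ ha hc del0 kal0 _ _ HG _ mp.
rewrite -conic_moveE // -/(step al be (orb n)) -[step _ _ _]/(orb n.+1) -/p.
rewrite -[n.+2%:R]natr1.
case => h2; [exists (z + 1)|exists z]; rewrite ?intrD; lra.
Qed.

(** The half step has landed on the pole, so the next point is infinity, of angle 0. *)
Lemma orb_angle_stop n : finite_orb al be a c n ->
  conic_den al be (half_step al be (orb n)) = 0 ->
  exists z : int, n.+2%:R * G p = z%:~R * Om.
Proof.
move=> gn D0.
have [z zE] := orb_angle _ gn; have [sO st] := orb_on _ gn.
have [mO mt] := half_step_on _ sO st.
have := refl_minus _ _ _ _ ha hc _ _ HG (orb n).1.1; rewrite -half_stepE // => h1.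
have mp : (half_step al be (orb n)).1.1 = p.
  by apply: (pole_unique _ _ _ _ ha hc del0 kal0); rewrite -curve_den.
rewrite mp in h1.
by exists (z + 1); rewrite -[n.+2%:R]natr1 intrD; lra.
Qed.

Lemma intmul_notin (Om' x : R) (z : int) : 0 < x < Om' -> x != z%:~R * Om'.
Proof.
move=> /andP[x0 x1]; have Om0 : 0 < Om' by exact: lt_trans x1.
apply/eqP => e; move: x0 x1; rewrite e pmulr_lgt0 // ltr0z => z0.
by rewrite -[ltRHS]mul1r ltr_pM2r // ltrz1 ltNge -gtz0_ge1 z0.
Qed.

(** Modulo [Om], k G p is the angle of the finite point number k - 1 of the orbit, hence nonzero. *)
Lemma finite_orb_irr n : finite_orb al be a c n ->
  forall k, (0 < k <= n.+1)%N -> forall z : int, k%:R * G p != z%:~R * Om.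
Proof.
move=> gn [//|k] /andP[_ kn] z.
have [_ G0 _ _ _] := HG.
have [w wE] := orb_angle _ (finite_orb_le n k kn gn).
have := intmul_notin Om _ (z - w) (G0 (orb k).1.1).
by apply: contraNneq => e; rewrite wE e intrB mulrBl.
Qed.

Lemma irr_finite_orb n :
  (forall k, (0 < k <= n.+1)%N -> forall z : int, k%:R * G p != z%:~R * Om) ->
  finite_orb al be a c n.
Proof.
elim: n => [//|n IH irr].
have gn : finite_orb al be a c n.
  by apply: IH => k /andP[k0 kn]; apply: irr; rewrite k0 ltnW.
move=> k; rewrite ltnS leq_eqVlt => /predU1P[->|]; last exact: gn.
apply/negP => /eqP /(orb_angle_stop _ gn)[z zE].
by have := irr n.+2 (leqnn _) z; rewrite zE eqxx.
Qed.

Lemma orbit_hits N r1 r2 : finite_orb al be a c N -> r1 < r2 ->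
  Om < N.+1%:R * (G r2 - G r1) ->
  exists n, finite_orb al be a c n /\ r1 < (orb n).1.1 < r2.
Proof.
move=> gN r12 hN.
have [_ G0 Glt _ _] := HG.
have Om0 : 0 < Om by have /andP[] := G0 0; exact: lt_trans.
have /andP[A0 _] := G0 r1; have /andP[_ B1] := G0 r2.
have hit := rotation_hits R (G p) Om (G r1) (G r2) N.+1 Om0 isT (ltW A0) (ltW B1) hN (finite_orb_irr _ gN).
pose P n := `[< exists z : int, (0 < n)%N /\ G r1 < n%:R * G p - z%:~R * Om < G r2 >].
have exP : exists n, P n by have [n [z h]] := hit; exists n; apply/asboolP; exists z.
(* The first hit is taken: a return to 0 after k turns before it would make n + 1 - k an earlier
   hit, so the orbit is still finite there. *)
case: (ex_minnP exP) => -[|n] /asboolP[z [// _ /andP[h1 h2]]] minn.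
have z01 : 0 < n.+1%:R * G p - z%:~R * Om < Om by apply/andP; split; lra.
have gn : finite_orb al be a c n.
  apply: irr_finite_orb => k /andP[k0 kn] w; apply/negP => /eqP kw.
  move: kn; rewrite leq_eqVlt => /predU1P[kn|kn].
    have := intmul_notin _ _ (w - z) z01; rewrite -kn kw intrB mulrBl.
    by rewrite eqxx.
  have /minn : P (n.+1 - k)%N.
    apply/asboolP; exists (z - w); split; first by rewrite subn_gt0.
    rewrite natrB 1?ltnW // intrB !mulrBl kw; apply/andP; split; lra.
  by rewrite -[in X in (X <= _)%N](subnKC (ltnW kn)) -[X in (_ <= X)%N]add0n leq_add2r leqNgt k0.
exists n; split => //.
have [w wE] := orb_angle _ gn.
have wz : w = z.
  have /andP[g0 g1] := G0 (orb n).1.1; move/andP: z01 => [z0 z1].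
  have h3 : `|w - z|%:~R * Om < 1 * Om.
    rewrite mul1r -[X in _ * X](gtr0_norm Om0) intr_norm -normrM intrB.
    by rewrite ltr_norml mulrBl; apply/andP; split; lra.
  move: h3; rewrite ltr_pM2r // ltrz1.
  by move=> h3; apply/eqP; rewrite -subr_eq0 -normr_eq0 eq_le normr_ge0 andbT -ltzD1 add0r.
have Gle x y : G x < G y -> x < y.
  by rewrite [x < y]ltNge; apply: contraTN; rewrite le_eqVlt -leNgt => /predU1P[->//|/Glt/ltW].
by apply/andP; split; apply: Gle; rewrite wE wz.
Qed.

End Orbit.

(** * Orbit estimates uniform in the line *)

Section LineDensity.
Context {R : realType}.
Implicit Types (al be a c eta r : R).

Lemma atan_near_pihalf (e : R) : 0 < e ->
  exists2 C, 0 < C & forall x, C < x -> pi / 2 - atan x < e.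
Proof.
move=> e0; have /cvgrPdist_lt /(_ e e0) := @cvgy_atan R.
move=> [M [Mr HM]]; exists (Num.max M 1); first by rewrite lt_max ltr01 orbT.
move=> x; rewrite gt_max => /andP[Mx _].
by have := HM x Mx; rewrite ltr_norml => /andP[].
Qed.

Lemma angle_bounds_gt0 eta al be a c : 0 < eta -> eta <= a - al ^+ 2 ->
  eta <= c - be ^+ 2 -> 0 < angle_bound_low eta a c /\ 0 < angle_bound_up a c.
Proof.
move=> eta0 hf hg.
have a0 : 0 < a by have := sqr_ge0 al; lra.
have c0 : 0 < c by have := sqr_ge0 be; lra.
split; first by rewrite divr_gt0 ?sqrtr_gt0 ?mulr_gt0 ?addr_gt0.
by rewrite sqrtr_gt0 mulr_gt0 ?addr_gt0 ?mulr_gt0.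
Qed.

Lemma line_angle_exists eta al be a c : 0 < eta -> eta <= a - al ^+ 2 ->
  eta <= c - be ^+ 2 ->
  let m := angle_bound_low eta a c in let M := angle_bound_up a c in
  exists (G : R -> R) (Om : R),
  [/\ is_line_angle al be a c G Om,
      forall x y, x <= y -> (atan y - atan x) / M <= G y - G x,
      forall r, G r <= (atan r + pi / 2) / m,
      forall r, Om - G r <= (pi / 2 - atan r) / m
    & pi / M <= Om <= pi / m].
Proof.
move=> eta0 hf hg m M.
have [m0 M0] := angle_bounds_gt0 _ _ _ _ _ eta0 hf hg; rewrite -/m -/M in m0 M0.
have [G [Om [dG Gxy Glow Gup]]] := angle_function _ _ _ _ _ eta0 hf hg.
rewrite -/m -/M in Gxy Glow Gup.
have api r := @atan_gtNpi2 R r.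
have bpi r := @atan_ltpi2 R r.
exists G, Om; split.
- split => //.
  + move=> r; have /andP[h1 _] := Glow r; have /andP[h2 _] := Gup r.
    apply/andP; split; first by apply: lt_le_trans h1; rewrite divr_gt0 //; have := api r; lra.
    by rewrite -subr_gt0; apply: lt_le_trans h2; rewrite divr_gt0 //; have := bpi r; lra.
  + move=> x y xy; rewrite -subr_gt0; have /andP[h _] := Gxy _ _ (ltW xy).
    by apply: lt_le_trans h; rewrite divr_gt0 // subr_gt0 lt_atan.
  + move=> e e0; have [C C0 HC] := atan_near_pihalf (e * m) (mulr_gt0 e0 m0).
    exists (- (C + 1)); have /andP[_ h] := Glow (- (C + 1)).
    apply: le_lt_trans h _; rewrite ltr_pdivrMr // atanN addrC; apply: HC; lra.
  + move=> e e0; have [C C0 HC] := atan_near_pihalf (e * m) (mulr_gt0 e0 m0).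
    exists (C + 1); have /andP[_ h] := Gup (C + 1).
    have : (pi / 2 - atan (C + 1)) / m < e by rewrite ltr_pdivrMr //; apply: HC; lra.
    by move: h; lra.
- by move=> x y /Gxy /andP[].
- by move=> r; have /andP[] := Glow r.
- by move=> r; have /andP[] := Gup r.
have /andP[h1 h2] := Glow 0; have /andP[h3 h4] := Gup 0.
have e1 : pi / M = (atan 0 + pi / 2) / M + (pi / 2 - atan 0) / M by rewrite -mulrDl; congr (_ / M); lra.
have e2 : pi / m = (atan 0 + pi / 2) / m + (pi / 2 - atan 0) / m by rewrite -mulrDl; congr (_ / m); lra.
by rewrite e1 e2; apply/andP; split; lra.
Qed.

(** The inequality on N does not involve [al] and [be], so N can be chosen before the slope. *)
Lemma line_hits eta al be a c N r1 r2 : 0 < eta -> eta <= a - al ^+ 2 ->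
  eta <= c - be ^+ 2 -> be - al != 0 -> kappa al be a c + al != 0 ->
  finite_orb al be a c N -> r1 < r2 ->
  pi / angle_bound_low eta a c < N.+1%:R * ((atan r2 - atan r1) / angle_bound_up a c) ->
  exists n, finite_orb al be a c n /\ r1 < (orb al be a c n).1.1 < r2.
Proof.
move=> eta0 hf hg del0 kal0 gN r12 hN.
have [G [Om [HG Gxy _ _ /andP[_ Omm]]]] := line_angle_exists _ _ _ _ _ eta0 hf hg.
have ha : al ^+ 2 < a by lra.
have hc : be ^+ 2 < c by lra.
apply: (orbit_hits _ _ _ _ ha hc del0 kal0 G Om HG N) => //.
apply: le_lt_trans Omm _; apply: lt_le_trans hN _.
by rewrite ler_pM2l ?ltr0n // Gxy // ltW.
Qed.

(** A far pole has angle close to 0 or to [Om], so its first N + 1 multiples do not complete a turn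
    in either sense. *)
Lemma finite_orb_of_large_pole eta a c N : 0 < eta ->
  exists2 C, 0 < C & forall al be, eta <= a - al ^+ 2 -> eta <= c - be ^+ 2 ->
    be - al != 0 -> kappa al be a c + al != 0 -> C < `|pole al be a c| ->
    finite_orb al be a c N.
Proof.
move=> eta0.
pose m := angle_bound_low eta a c; pose M := angle_bound_up a c.
(* The existence of [al] and [be] as required forces m and M to be positive; otherwise the claim is
   vacuous. *)
have [mM0|mM0] := leP (m * (pi / M) / N.+1%:R) 0.
  exists 1 => // al be hf hg.
  have [m0 M0] := angle_bounds_gt0 _ _ _ _ _ eta0 hf hg.
  suff : 0 < m * (pi / M) / N.+1%:R by rewrite ltNge mM0.
  by rewrite divr_gt0 ?ltr0n // mulr_gt0 // divr_gt0 // pi_gt0.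
have [C C0 HC] := atan_near_pihalf _ mM0; exists C => // al be hf hg del0 kal0.
have [m0 M0] := angle_bounds_gt0 _ _ _ _ _ eta0 hf hg; rewrite -/m -/M in m0 M0.
have [G [Om [HG _ Glow Gup /andP[OmM _]]]] := line_angle_exists _ _ _ _ _ eta0 hf hg.
rewrite -/m -/M in Glow Gup OmM.
have ha : al ^+ 2 < a by lra.
have hc : be ^+ 2 < c by lra.
have small x : C < x -> N.+1%:R * ((pi / 2 - atan x) / m) < Om.
  move=> /HC; rewrite ltr_pdivlMr ?ltr0n // => h; apply: lt_le_trans OmM.
  by rewrite mulrA ltr_pdivrMr // mulrC [ltRHS]mulrC.
set p := pole al be a c => Cp.
apply: (irr_finite_orb _ _ _ _ ha hc del0 kal0 G Om HG) => k /andP[k0 kN] z.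
have kN' : k%:R <= N.+1%:R :> R by rewrite ler_nat.
have kR : 0 < k%:R :> R by rewrite ltr0n.
have [_ G0 _ _ _] := HG; have /andP[G1 G2] := G0 p.
move: Cp; rewrite ltr_normr => /orP[] /small h.
  have kz := intmul_notin Om (k%:R * (Om - G p)) (k%:Z - z).
  have := kz; rewrite intrB mulrBl mulrBr -pmulrn -/p.
  have lt : 0 < k%:R * Om - k%:R * G p < Om.
    rewrite -mulrBr; rewrite mulr_gt0 ?subr_gt0 //=; apply: le_lt_trans h.
    by apply: ler_pM => //; rewrite subr_ge0 ltW.
  by move=> /(_ lt); apply: contraNneq => ->.
apply: intmul_notin; rewrite mulr_gt0 //=; apply: le_lt_trans h.
apply: ler_pM => //; first exact: ltW.
by rewrite atanN opprK [pi / 2 + _]addrC; exact: Glow.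
Qed.

End LineDensity.

(** * Rational dependence on the slope *)

Section RationalNumbers.
Context {R : realType}.
Implicit Types x y : R.

Lemma rational_ratr (q : rat) : rational (ratr q : R).
Proof. by exists q. Qed.

Lemma rationalD x y : rational x -> rational y -> rational (x + y).
Proof. by move=> [p _ <-] [q _ <-]; exists (p + q) => //; rewrite rmorphD. Qed.

Lemma rationalN x : rational x -> rational (- x).
Proof. by move=> [p _ <-]; exists (- p) => //; rewrite rmorphN. Qed.

Lemma rationalB x y : rational x -> rational y -> rational (x - y).
Proof. by move=> hx hy; apply: rationalD => //; exact: rationalN. Qed.

Lemma rationalM x y : rational x -> rational y -> rational (x * y).
Proof. by move=> [p _ <-] [q _ <-]; exists (p * q) => //; rewrite rmorphM. Qed.

Lemma rationalV x : rational x -> rational x^-1.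
Proof. by move=> [p _ <-]; exists p^-1 => //; rewrite fmorphV. Qed.

Lemma rational_div x y : rational x -> rational y -> rational (x / y).
Proof. by move=> hx hy; apply: rationalM => //; exact: rationalV. Qed.

Lemma rationalX x n : rational x -> rational (x ^+ n).
Proof. by move=> [p _ <-]; exists (p ^+ n) => //; rewrite rmorphXn. Qed.

Lemma rational_nat n : rational (n%:R : R).
Proof. by exists n%:R => //; rewrite rmorph_nat. Qed.

Lemma rational_norm x : rational x -> rational `|x|.
Proof. by move=> [p _ <-]; exists `|p| => //; rewrite ratr_norm. Qed.

End RationalNumbers.

Ltac rational_tac := repeat first
  [ assumption | apply: rational_ratr | exact: rational_nat 1%N | exact: rational_nat 0%N
  | apply: rational_nat | apply: rationalB | apply: rationalD
  | apply: rationalN | apply: rational_div | apply: rationalM | apply: rationalV | apply: rationalX ].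

(** * Properties valid for all but finitely many slopes *)

Section Generic.
Context {R : realType}.
Implicit Types (P Q : R -> Prop) (g h : R -> R).

Definition generic P := exists2 q : {poly R}, q != 0 & forall t, q.[t] != 0 -> P t.

Lemma generic_and P Q : generic P -> generic Q -> generic (fun t => P t /\ Q t).
Proof.
move=> [p p0 Hp] [q q0 Hq]; exists (p * q); first by rewrite mulf_neq0.
by move=> t; rewrite hornerM mulf_eq0 negb_or => /andP[/Hp ? /Hq].
Qed.

Lemma genericW P Q : (forall t, P t -> Q t) -> generic P -> generic Q.
Proof. by move=> PQ [p p0 Hp]; exists p => // t /Hp /PQ. Qed.

Lemma generic_rational P (t1 t2 : R) : t1 < t2 -> generic P ->
  exists t : rat, t1 < ratr t < t2 /\ P (ratr t).
Proof.
move=> t12 [q q0 Hq].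
have [r1] := rat_in_itvoo t12; rewrite in_itv /= => /andP[h1 h2].
have [r2] := rat_in_itvoo h2; rewrite in_itv /= => /andP[h3 h4].
have r12 : r1 < r2 by rewrite -(ltr_rat R).
pose x i : rat := r1 + (r2 - r1) / i.+1%:R.
pose s := [seq (ratr (x i) : R) | i <- iota 0 (size q)].
have us : uniq s.
  rewrite map_inj_uniq ?iota_uniq // => i j /(fmorph_inj _) /addrI /mulfI e.
  have /e /invr_inj /eqP : r2 - r1 != 0 by rewrite subr_eq0 gt_eqF.
  by rewrite eqr_nat eqSS => /eqP.
have /allPn[y /mapP[i _ ->] yr] : ~~ all (root q) s.
  apply/negP => als; have := max_poly_roots q0 als us.
  by rewrite size_map size_iota ltnn.
exists (x i); split; last exact: Hq.
have i1 : 1 <= i.+1%:R :> rat by rewrite ler1n.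
have i0 : 0 < i.+1%:R :> rat by rewrite ltr0n.
have d0 : 0 < (r2 - r1) / i.+1%:R by rewrite divr_gt0 // subr_gt0.
have d1 : (r2 - r1) / i.+1%:R <= r2 - r1 by rewrite ler_pdivrMr // ler_peMr // subr_ge0 ltW.
apply/andP; split.
  by apply: lt_trans h1 _; rewrite ltr_rat /x ltrDl.
by apply: le_lt_trans h4; rewrite ler_rat /x -lerBrDl.
Qed.

(** Agreement with p / q is asked only off the zeros of q, so the class is closed under all field
    operations, inversion with value 0 at 0 included. *)
Definition ratfun g := exists p q : {poly R}, q != 0 /\
  forall t, q.[t] != 0 -> g t = p.[t] / q.[t].

Lemma ratfun_cst (d : R) : ratfun (fun=> d).
Proof. by exists d%:P, 1; rewrite oner_eq0; split => // t _; rewrite !hornerC divr1. Qed.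

Lemma ratfun_id : ratfun (fun t => t).
Proof. by exists 'X, 1; rewrite oner_eq0; split => // t _; rewrite hornerX hornerC divr1. Qed.

Lemma ratfunD g h : ratfun g -> ratfun h -> ratfun (fun t => g t + h t).
Proof.
move=> [p [q [q0 H]]] [p' [q' [q0' H']]].
exists (p * q' + p' * q), (q * q'); split; first by rewrite mulf_neq0.
move=> t; rewrite hornerM mulf_eq0 negb_or => /andP[t0 t0'].
by rewrite H // H' // hornerD !hornerM; field; rewrite t0 t0'.
Qed.

Lemma ratfunM g h : ratfun g -> ratfun h -> ratfun (fun t => g t * h t).
Proof.
move=> [p [q [q0 H]]] [p' [q' [q0' H']]].
exists (p * p'), (q * q'); split; first by rewrite mulf_neq0.
move=> t; rewrite hornerM mulf_eq0 negb_or => /andP[t0 t0'].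
by rewrite H // H' // !hornerM; field; rewrite t0 t0'.
Qed.

Lemma ratfunN g : ratfun g -> ratfun (fun t => - g t).
Proof.
move=> [p [q [q0 H]]]; exists (- p), q; split=> // t t0.
by rewrite H // hornerN mulNr.
Qed.

Lemma ratfunB g h : ratfun g -> ratfun h -> ratfun (fun t => g t - h t).
Proof. by move=> hg hh; apply: ratfunD => //; exact: ratfunN. Qed.

Lemma ratfunX g n : ratfun g -> ratfun (fun t => g t ^+ n).
Proof.
move=> hg; elim: n => [|n IH]; first exact: (ratfun_cst 1).
by rewrite (_ : (fun _ => _) = fun t => g t * g t ^+ n); [exact: ratfunM|apply/funext => t; rewrite exprS].
Qed.

Lemma ratfun_dichotomy g : ratfun g ->
  generic (fun t => g t != 0) \/ generic (fun t => g t = 0).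
Proof.
move=> [p [q [q0 H]]]; have [p0|p0] := eqVneq p 0.
  by right; exists q => // t /H ->; rewrite p0 horner0 mul0r.
left; exists (p * q); first by rewrite mulf_neq0.
move=> t; rewrite hornerM mulf_eq0 negb_or => /andP[pt qt].
by rewrite H // mulf_neq0 // invr_eq0.
Qed.

Lemma ratfunV g : ratfun g -> ratfun (fun t => (g t)^-1).
Proof.
move=> [p [q [q0 H]]]; have [p0|p0] := eqVneq p 0.
  exists 0, q; split=> // t t0.
  by rewrite H // p0 horner0 !mul0r invr0.
exists (q * q), (p * q); split; first by rewrite mulf_neq0.
move=> t; rewrite hornerM mulf_eq0 negb_or => /andP[t0 t0'].
by rewrite H // hornerM; field; rewrite t0 t0'.
Qed.

Lemma ratfun_div g h : ratfun g -> ratfun h -> ratfun (fun t => g t / h t).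
Proof. by move=> hg hh; apply: ratfunM => //; exact: ratfunV. Qed.

Definition ratfun3 (s : R -> R * R * R) :=
  [/\ ratfun (fun t => (s t).1.1), ratfun (fun t => (s t).1.2) & ratfun (fun t => (s t).2)].

Lemma ratfun3_flip s : ratfun3 s -> ratfun3 (fun t => flip (s t)).
Proof. by case=> *; split => //; exact: ratfunN. Qed.

Section Orbit.
Variables (al be : R -> R) (a c : R).
Hypotheses (hal : ratfun al) (hbe : ratfun be).

Lemma ratfun_conic_den s : ratfun3 s -> ratfun (fun t => conic_den (al t) (be t) (s t)).
Proof.
by case=> *; apply: ratfunB; apply: ratfunX; apply: ratfunB.
Qed.

Lemma ratfun3_conic_move s : ratfun3 s ->
  ratfun3 (fun t => conic_move (al t) (be t) (s t)).
Proof.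
move=> hs; have [h1 h2 h3] := hs.
have hk : ratfun (fun t => conic_ratio (al t) (be t) (s t)).
  apply: ratfun_div; last exact: ratfun_conic_den.
  apply: ratfunM; first exact: ratfun_cst.
  by apply: ratfunB; apply: ratfunM => //; exact: ratfunB.
split; apply: ratfunD => //; apply: ratfunM => //; exact: ratfunB.
Qed.

Lemma ratfun3_half_step s : ratfun3 s ->
  ratfun3 (fun t => half_step (al t) (be t) (s t)).
Proof.
by move=> hs; apply: ratfun3_flip; apply: ratfun3_conic_move; exact: ratfun3_flip.
Qed.

Lemma ratfun_kappa : ratfun (fun t => kappa (al t) (be t) a c).
Proof.
apply: ratfun_div; last by apply: ratfunM; [exact: ratfun_cst|exact: ratfunB].
apply: ratfunB; last exact: ratfun_cst.
by apply: ratfunD; [apply: ratfunX; exact: ratfunB|exact: ratfun_cst].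
Qed.

Lemma ratfun3_orb n : ratfun3 (fun t => orb (al t) (be t) a c n).
Proof.
elim: n => [|n IH].
  have hk := ratfun_kappa.
  have hp : ratfun (fun t => pole (al t) (be t) a c).
    apply: ratfun_div; first by apply: ratfunB; [exact: ratfun_cst|exact: ratfunX].
    by apply: ratfunM; [exact: ratfun_cst|exact: ratfunD].
  split => //; first exact: ratfunD.
  by apply: ratfunB; [exact: ratfunD|exact: ratfunB].
by apply: ratfun3_conic_move; exact: ratfun3_half_step.
Qed.

(* By the dichotomy for rational functions, a denominator that is nonzero at
   suitable parameters of a single interval is nonzero generically. *)
Lemma generic_finite_orb :
  (forall N, exists t1 t2, t1 < t2 /\
     generic (fun t => t1 < t < t2 -> finite_orb (al t) (be t) a c N)) ->
  forall N, generic (fun t => finite_orb (al t) (be t) a c N).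
Proof.
move=> ex; elim=> [|N IH]; first by exists 1; rewrite ?oner_eq0.
have den_rf := ratfun_conic_den _ (ratfun3_half_step _ (ratfun3_orb N)).
have [gn|gz] := ratfun_dichotomy _ den_rf.
  apply: genericW (generic_and _ _ IH gn) => t [gN dN] k.
  by rewrite ltnS leq_eqVlt => /predU1P[->|]; [exact: dN|exact: gN].
have [t1 [t2 [t12 g1]]] := ex N.+1.
have [t [tt [/(_ tt) gt zt]]] := generic_rational _ _ _ t12 (generic_and _ _ g1 gz).
by have := gt N (ltnSn N); rewrite zt eqxx.
Qed.

End Orbit.
End Generic.

Lemma rational_conic_move (R : realType) (al be : R) (s : R * R * R) :
  rational al -> rational be ->
  [/\ rational s.1.1, rational s.1.2 & rational s.2] ->
  [/\ rational (conic_move al be s).1.1, rational (conic_move al be s).1.2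
    & rational (conic_move al be s).2].
Proof.
move=> ra rb [r1 r2 r3]; split; rewrite /conic_move /conic_ratio /conic_num /conic_den /=;
  rational_tac.
Qed.

Lemma rational_orb (R : realType) (al be a c : R) n :
  rational al -> rational be -> rational a -> rational c ->
  [/\ rational (orb al be a c n).1.1, rational (orb al be a c n).1.2
    & rational (orb al be a c n).2].
Proof.
move=> ra rb rA rC; elim: n => [|n IH].
  have rk : rational (kappa al be a c) by rewrite /kappa; rational_tac.
  by split; rewrite /= /pole; rational_tac.
have rflip s : [/\ rational s.1.1, rational s.1.2 & rational s.2] ->
    [/\ rational (flip s).1.1, rational (flip s).1.2 & rational (flip (F := R) s).2].
  by case=> *; split => //=; exact: rationalN.
by apply: rational_conic_move => //; apply: (rflip); apply: rational_conic_move => //; exact: rflip.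
Qed.

(** * The pencil of lines through P3 *)

Section Plane.
Context {R : realType}.
Variable (D : R).
Hypothesis D0 : 0 < D.
Implicit Types (t : R).

(* Coordinates refer to an orthogonal basis of vectors of squared norms 1 and D. *)
Definition dirx D t : R := (1 - D * t ^+ 2) / (1 + D * t ^+ 2).
Definition diry D t : R := 2 * t / (1 + D * t ^+ 2).
Definition dir_dot D (u1 u2 t : R) := u1 * dirx D t + D * (u2 * diry D t).
Definition dir_cross D (u1 u2 t : R) := u1 * diry D t - u2 * dirx D t.

Let ex := dirx D.
Let ey := diry D.
Let dot := dir_dot D.
Let cross := dir_cross D.

Lemma dir_den_gt0 t : 0 < 1 + D * t ^+ 2.
Proof. by rewrite ltr_pwDl // mulr_ge0 ?sqr_ge0 // ltW. Qed.

Lemma dir_norm t : ex t ^+ 2 + D * ey t ^+ 2 = 1.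
Proof. by rewrite /ex /ey /dirx /diry; field; rewrite gt_eqF // dir_den_gt0. Qed.

(** Gram determinant of a vector and a unit direction: the squared distance from the point (u1, u2)
    to the line. *)
Lemma lagrange u1 u2 t :
  u1 ^+ 2 + D * u2 ^+ 2 - dot u1 u2 t ^+ 2 = D * cross u1 u2 t ^+ 2.
Proof.
transitivity ((u1 ^+ 2 + D * u2 ^+ 2) * (ex t ^+ 2 + D * ey t ^+ 2) - dot u1 u2 t ^+ 2).
  by rewrite dir_norm mulr1.
by rewrite /dot /cross /dir_dot /dir_cross -/(ex t) -/(ey t); ring.
Qed.

(** The parameter is y2 / (rho + y1), a half-angle tangent. The direction (-1, 0) has no parameter
    and is reached with t = 0 and a negative [rho]. *)
Lemma polar_coordinates (y1 y2 : R) : exists t rho, y1 = rho * ex t /\ y2 = rho * ey t.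
Proof.
have [->|y20] := eqVneq y2 0.
  exists 0, y1; rewrite /ex /ey /dirx /diry expr0n /= !mulr0 subr0 addr0 divr1.
  by rewrite mul0r !mulr0 mulr1.
pose rho := Num.sqrt (y1 ^+ 2 + D * y2 ^+ 2).
have y2p : 0 < D * y2 ^+ 2 by rewrite mulr_gt0 // lt_def sqr_ge0 sqrf_eq0 y20.
have rhoE : rho ^+ 2 = y1 ^+ 2 + D * y2 ^+ 2.
  by rewrite sqr_sqrtr // addr_ge0 ?sqr_ge0 // ltW.
have rho0 : 0 <= rho by exact: sqrtr_ge0.
have ry : 0 < rho + y1.
  have := ler_norm (- y1); rewrite normrN => h.
  have : `|y1| < rho.
    by rewrite -ltr_sqr ?nnegrE // rhoE real_normK ?num_real // ltrDl.
  lra.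
exists (y2 / (rho + y1)), rho; rewrite /ex /ey /dirx /diry.
have rhop : 0 < rho.
  by rewrite lt_def rho0 andbT -sqrf_eq0 rhoE gt_eqF // ltr_wpDl ?sqr_ge0.
have e1 : 1 + D * (y2 / (rho + y1)) ^+ 2 = 2 * rho / (rho + y1).
  have -> : D * (y2 / (rho + y1)) ^+ 2 = (rho ^+ 2 - y1 ^+ 2) / (rho + y1) ^+ 2.
    by rewrite rhoE; field; exact: lt0r_neq0.
  by field; exact: lt0r_neq0.
have e2 : 1 - D * (y2 / (rho + y1)) ^+ 2 = 2 * y1 / (rho + y1).
  have -> : D * (y2 / (rho + y1)) ^+ 2 = (rho ^+ 2 - y1 ^+ 2) / (rho + y1) ^+ 2.
    by rewrite rhoE; field; exact: lt0r_neq0.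
  by field; exact: lt0r_neq0.
by rewrite e1 e2; split; field; rewrite !lt0r_neq0.
Qed.

Lemma ratfun_dirx : ratfun ex.
Proof.
have h : ratfun (fun t => D * t ^+ 2).
  by apply: ratfunM; [exact: ratfun_cst|apply: ratfunX; exact: ratfun_id].
by apply: ratfun_div; [apply: ratfunB|apply: ratfunD] => //; exact: ratfun_cst.
Qed.

Lemma ratfun_diry : ratfun ey.
Proof.
have h : ratfun (fun t => D * t ^+ 2).
  by apply: ratfunM; [exact: ratfun_cst|apply: ratfunX; exact: ratfun_id].
apply: ratfun_div; last by apply: ratfunD => //; exact: ratfun_cst.
by apply: ratfunM; [exact: ratfun_cst|exact: ratfun_id].
Qed.

Lemma ratfun_dot u1 u2 : ratfun (dot u1 u2).
Proof.
apply: ratfunD; apply: ratfunM; try exact: ratfun_cst; first exact: ratfun_dirx.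
by apply: ratfunM; [exact: ratfun_cst|exact: ratfun_diry].
Qed.

Lemma generic_cross u1 u2 : (u1 != 0) || (u2 != 0) ->
  generic (fun t => cross u1 u2 t != 0).
Proof.
move=> u0.
pose q : {poly R} := (2 * u1) *: 'X - u2 *: (1 - D *: 'X^2).
have qE t : q.[t] = 2 * u1 * t - u2 * (1 - D * t ^+ 2).
  by rewrite /q !hornerE.
exists q.
  apply: contraTneq u0 => q0.
  have q_0 : q.[0] = 0 by rewrite q0 horner0.
  have q_1 : q.[1] = 0 by rewrite q0 horner0.
  move: q_0 q_1; rewrite !qE expr0n /= !mulr0 subr0 mulr1 sub0r => /eqP.
  rewrite oppr_eq0 => /eqP ->; rewrite mul0r subr0 mulr1 => /eqP.
  by rewrite mulf_eq0 pnatr_eq0 /= => /eqP ->; rewrite eqxx.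
move=> t; rewrite qE; apply: contraNneq => c0.
have -> : 2 * u1 * t - u2 * (1 - D * t ^+ 2) = cross u1 u2 t * (1 + D * t ^+ 2).
  by rewrite /cross /dir_cross /dirx /diry; field; rewrite lt0r_neq0 // dir_den_gt0.
by rewrite c0 mul0r.
Qed.

Lemma continuous_dirx t : {for t, continuous (ex)}.
Proof.
have -> : ex = fun t => (1 - D * t ^+ 2) / (1 + D * t ^+ 2) by [].
have ct : {for t, continuous (fun t : R => D * t ^+ 2)}.
  by apply: continuousM; [exact: cvg_cst|exact: exprn_continuous].
apply: continuousM; first by apply: continuousB => //; exact: cvg_cst.
by apply: continuousV; [rewrite lt0r_neq0 // dir_den_gt0|apply: continuousD => //; exact: cvg_cst].
Qed.

Lemma continuous_diry t : {for t, continuous (ey)}.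
Proof.
have -> : ey = fun t => 2 * t / (1 + D * t ^+ 2) by [].
have ct : {for t, continuous (fun t : R => D * t ^+ 2)}.
  by apply: continuousM; [exact: cvg_cst|exact: exprn_continuous].
apply: continuousM; first by apply: continuousM; [exact: cvg_cst|exact: cvg_id].
by apply: continuousV; [rewrite lt0r_neq0 // dir_den_gt0|apply: continuousD => //; exact: cvg_cst].
Qed.

Lemma continuous_dot u1 u2 t : {for t, continuous (dot u1 u2)}.
Proof.
have -> : dot u1 u2 = fun t => u1 * ex t + D * (u2 * ey t) by [].
have cx : {for t, continuous (fun t => u1 * ex t)}.
  by apply: continuousM; [exact: cvg_cst|exact: continuous_dirx].
have cy : {for t, continuous (fun t => D * (u2 * ey t))}.
  apply: continuousM; first exact: cvg_cst.
  by apply: continuousM; [exact: cvg_cst|exact: continuous_diry].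
exact: (continuousD cx cy).
Qed.

Lemma near_interval (P : R -> Prop) (t0 : R) : (\forall t \near t0, P t) ->
  exists2 d, 0 < d & forall t, t0 - d < t < t0 + d -> P t.
Proof.
move=> /nbhs_ballP[d /= d0 H]; exists d => // t tt; apply: H.
by rewrite /ball /= distrC ltr_norml; move: tt => /andP[? ?]; apply/andP; split; lra.
Qed.

Lemma continuous_gt0_near (h : R -> R) t0 : {for t0, continuous h} -> 0 < h t0 ->
  \forall t \near t0, 0 < h t.
Proof. by move=> ch h0; apply: (cvgr_gt _ ch). Qed.

Section TwoVectors.
Variables (u1 u2 v1 v2 : R).
Hypothesis uv : u1 * v2 - u2 * v1 != 0.
Let a := u1 ^+ 2 + D * u2 ^+ 2.
Let c := v1 ^+ 2 + D * v2 ^+ 2.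
Let al := dot u1 u2.
Let be := dot v1 v2.

Lemma dotB t : be t - al t = dot (v1 - u1) (v2 - u2) t.
Proof. by rewrite /be /al /dot /dir_dot; ring. Qed.

Lemma kappa_al t : be t - al t != 0 ->
  kappa (al t) (be t) a c + al t =
  D * (cross u1 u2 t ^+ 2 - cross v1 v2 t ^+ 2) / (2 * (be t - al t)).
Proof.
move=> del0; rewrite mulrBr -!lagrange -/a -/c -/(al t) -/(be t) /kappa.
by field.
Qed.

(** The conditions exclude lines perpendicular to P1P2, parallel to it, or through the midpoint of
    P1 and P2. By [kappa_al] the last two are the lines equidistant from P1 and P2. *)
Lemma generic_line : generic (fun t => be t - al t != 0 /\
  kappa (al t) (be t) a c + al t != 0).
Proof.
have g1 : generic (fun t => cross (D * (v2 - u2)) (- (v1 - u1)) t != 0).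
  apply: generic_cross; rewrite mulf_eq0 (gt_eqF D0) /= oppr_eq0 -negb_and.
  apply: contraNN uv => /andP[/eqP e2 /eqP e1].
  have -> : v2 = u2 by apply/eqP; rewrite -subr_eq0 e2.
  have -> : v1 = u1 by apply/eqP; rewrite -subr_eq0 e1.
  by rewrite mulrC subrr.
have g2 : generic (fun t => cross (v1 - u1) (v2 - u2) t != 0).
  apply: generic_cross; rewrite -negb_and.
  apply: contraNN uv => /andP[/eqP e1 /eqP e2].
  have -> : v2 = u2 by apply/eqP; rewrite -subr_eq0 e2.
  have -> : v1 = u1 by apply/eqP; rewrite -subr_eq0 e1.
  by rewrite mulrC subrr.
have g3 : generic (fun t => cross (v1 + u1) (v2 + u2) t != 0).
  apply: generic_cross; rewrite -negb_and.
  apply: contraNN uv => /andP[/eqP e1 /eqP e2].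
  have -> : v2 = - u2 by apply/eqP; rewrite -addr_eq0 e2.
  have -> : v1 = - u1 by apply/eqP; rewrite -addr_eq0 e1.
  by rewrite mulrN mulrC mulrN subrr.
apply: genericW (generic_and _ _ g1 (generic_and _ _ g2 g3)) => t [h1 [h2 h3]].
have del0 : be t - al t != 0.
  have -> // : be t - al t = cross (D * (v2 - u2)) (- (v1 - u1)) t.
  by rewrite dotB /dot /cross /dir_dot /dir_cross; ring.
split => //; rewrite kappa_al //.
have -> : cross u1 u2 t ^+ 2 - cross v1 v2 t ^+ 2 =
    - (cross (v1 - u1) (v2 - u2) t * cross (v1 + u1) (v2 + u2) t).
  by rewrite /cross /dir_cross; ring.
rewrite mulrN mulNr oppr_eq0 !mulf_neq0 // ?invr_neq0 ?mulf_neq0 //.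
exact: lt0r_neq0.
Qed.

(* The pole escapes to infinity as the line becomes parallel to v - u. *)
Lemma finite_orb_near_parallel N : exists t1 t2, t1 < t2 /\
  generic (fun t => t1 < t < t2 -> finite_orb (al t) (be t) a c N).
Proof.
have [t0 [rho [y1 y2]]] := polar_coordinates (v1 - u1) (v2 - u2).
have uy : u1 * v2 - u2 * v1 = rho * cross u1 u2 t0.
  have -> : u1 * v2 - u2 * v1 = u1 * (v2 - u2) - u2 * (v1 - u1) by ring.
  by rewrite y1 y2 /cross /dir_cross -/(ex t0) -/(ey t0); ring.
have := uv; rewrite uy mulf_eq0 negb_or => /andP[rho0 cu0].
have cuv : cross v1 v2 t0 = cross u1 u2 t0.
  have -> : cross v1 v2 t0 = cross u1 u2 t0 + ((v1 - u1) * ey t0 - (v2 - u2) * ex t0).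
    by rewrite /cross /dir_cross -/(ex t0) -/(ey t0); ring.
  by rewrite y1 y2; ring.
have del : be t0 - al t0 = rho.
  rewrite dotB /dot /dir_dot y1 y2 -/(ex t0) -/(ey t0).
  transitivity (rho * (ex t0 ^+ 2 + D * ey t0 ^+ 2)); first by ring.
  by rewrite dir_norm mulr1.
have del0 : be t0 - al t0 != 0 by rewrite del.
have h1 : 0 < a - al t0 ^+ 2 by rewrite lagrange mulr_gt0 // lt_def sqr_ge0 sqrf_eq0 cu0.
have h2 : c - be t0 ^+ 2 = a - al t0 ^+ 2 by rewrite !lagrange cuv.
have kal0 : kappa (al t0) (be t0) a c + al t0 = 0.
  by rewrite kappa_al // cuv subrr mulr0 mul0r.
pose eta := (a - al t0 ^+ 2) / 2.
have eta0 : 0 < eta by rewrite divr_gt0.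
have [C C0 HC] := finite_orb_of_large_pole eta a c N eta0.
have cal : {for t0, continuous al} by exact: continuous_dot.
have cbe : {for t0, continuous be} by exact: continuous_dot.
have ccst (d : R) : {for t0, continuous (fun _ : R => d)} by exact: cvg_cst.
have sqr_cont (h : R -> R) : {for t0, continuous h} -> {for t0, continuous (fun t => h t ^+ 2)}.
  move=> ch; rewrite (_ : (fun t => _) = fun t => h t * h t); first exact: continuousM.
  by apply/funext => t; rewrite expr2.
have norm_cont (h : R -> R) : {for t0, continuous h} -> {for t0, continuous (fun t => `|h t|)}.
  by move=> ch; apply: (continuous_comp ch); exact: norm_continuous.
have ck : {for t0, continuous (fun t => kappa (al t) (be t) a c)}.
  apply: continuousM.
    apply: continuousB => //; apply: continuousD => //; apply: sqr_cont.
    exact: continuousB.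
  apply: continuousV; first by rewrite mulf_neq0.
  by apply: continuousM => //; exact: continuousB.
(* [phi t > 0] is the bound C < |pole| cleared of its denominator, hence usable by continuity at
   [t0], where that denominator is 0. *)
pose phi t := `|a - kappa (al t) (be t) a c ^+ 2| - C * `|2 * (kappa (al t) (be t) a c + al t)|.
have cphi : {for t0, continuous phi}.
  apply: continuousB; first by apply: norm_cont; apply: continuousB => //; exact: sqr_cont.
  apply: continuousM => //; apply: norm_cont; apply: continuousM => //.
  exact: continuousD.
have phi0 : 0 < phi t0.
  rewrite /phi kal0 mulr0 normr0 mulr0 subr0 normr_gt0.
  have -> : kappa (al t0) (be t0) a c = - al t0 by apply/eqP; rewrite -subr_eq0 opprK kal0.
  by rewrite sqrrN lt0r_neq0.
have [d d0 Hd] : exists2 d, 0 < d & forall t, t0 - d < t < t0 + d ->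
    (0 < a - al t ^+ 2 - eta /\ 0 < c - be t ^+ 2 - eta) /\ 0 < phi t.
  apply: near_interval; near=> t; split; first split.
  - near: t; apply: (continuous_gt0_near (fun t => a - al t ^+ 2 - eta)).
      by apply: continuousB => //; apply: continuousB => //; exact: sqr_cont.
    by rewrite /eta; lra.
  - near: t; apply: (continuous_gt0_near (fun t => c - be t ^+ 2 - eta)).
      by apply: continuousB => //; apply: continuousB => //; exact: sqr_cont.
    by rewrite h2 /eta; lra.
  - by near: t; exact: continuous_gt0_near.
exists (t0 - d), (t0 + d); split; first lra.
apply: genericW generic_line => t [del0t kalt] /Hd[[ha hc] ph].
apply: HC => //; [lra|lra|].
by rewrite /pole normrM normfV ltr_pdivlMr ?normr_gt0 ?mulf_neq0 // -subr_gt0.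
Unshelve. all: by end_near. Qed.

Lemma generic_finite_orb_line N : generic (fun t => finite_orb (al t) (be t) a c N).
Proof.
apply: generic_finite_orb; [exact: ratfun_dot|exact: ratfun_dot|exact: finite_orb_near_parallel].
Qed.

Hypotheses (rD : rational D) (ru1 : rational u1) (ru2 : rational u2)
  (rv1 : rational v1) (rv2 : rational v2).

Lemma rational_points_dense (X0 Y0 eps : R) : 0 < eps -> exists X Y : R,
  [/\ rational X, rational Y, `|X - X0| < eps, `|Y - Y0| < eps
  & exists r s w : R, [/\ rational r, rational s & rational w] /\
    [/\ X ^+ 2 + D * Y ^+ 2 = r ^+ 2,
        (X - u1) ^+ 2 + D * (Y - u2) ^+ 2 = s ^+ 2
      & (X - v1) ^+ 2 + D * (Y - v2) ^+ 2 = w ^+ 2]].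
Proof.
move=> eps0.
have [t0 [r0 [X0E Y0E]]] := polar_coordinates X0 Y0.
have ccst (t d : R) : {for t, continuous (fun _ : R => d)} by exact: cvg_cst.
have sqr_cont t (h : R -> R) : {for t, continuous h} -> {for t, continuous (fun t => h t ^+ 2)}.
  move=> ch; rewrite (_ : (fun t => _) = fun t => h t * h t); first exact: continuousM.
  by apply/funext => x; rewrite expr2.
have [d1 d10 Hd1] : exists2 d, 0 < d & forall t, t0 - d < t < t0 + d ->
    forall r, `|r - r0| < d -> `|r * ex t - X0| < eps /\ `|r * ey t - Y0| < eps.
  have prod_near (h : R -> R) : {for t0, continuous h} ->
      exists2 d, 0 < d & forall t, t0 - d < t < t0 + d ->
      forall r, `|r - r0| < d -> `|r * h t - r0 * h t0| < eps.
    move=> ch.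
    have e1 : 0 < eps / (2 * (`|r0| + 1)) by rewrite divr_gt0 ?mulr_gt0 ?ltr_wpDl.
    have e2 : 0 < eps / (2 * (`|h t0| + 1)) by rewrite divr_gt0 ?mulr_gt0 ?ltr_wpDl.
    have [d d0 Hd] : exists2 d, 0 < d & forall t, t0 - d < t < t0 + d ->
        `|h t - h t0| < eps / (2 * (`|r0| + 1)) /\ `|h t - h t0| < 1.
      apply: near_interval; near=> t; split; rewrite distrC; near: t;
        by have /cvgrPdist_lt := ch; exact.
    exists (Num.min d (eps / (2 * (`|h t0| + 1)))); first by rewrite lt_min d0.
    move=> t; set m := Num.min _ _ => /andP[tm1 tm2] r rr.
    have md : m <= d by rewrite ge_min lexx.
    have me : m <= eps / (2 * (`|h t0| + 1)) by rewrite ge_min lexx orbT.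
    have [] := Hd t; first by apply/andP; split; lra.
    move=> k1 k2.
    have -> : r * h t - r0 * h t0 = (r - r0) * h t + r0 * (h t - h t0) by ring.
    apply: le_lt_trans (ler_normD _ _) _; rewrite !normrM.
    have ht : `|h t| <= `|h t0| + 1.
      have -> : h t = h t0 + (h t - h t0) by ring.
      by apply: le_trans (ler_normD _ _) _; rewrite lerD2l ltW.
    have b1 : `|r - r0| * `|h t| <= `|r - r0| * (`|h t0| + 1) by rewrite ler_wpM2l.
    have b2 : `|r - r0| * (`|h t0| + 1) < eps / (2 * (`|h t0| + 1)) * (`|h t0| + 1).
      by rewrite ltr_pM2r ?ltr_wpDl //; exact: lt_le_trans me.
    have b3 : `|r0| * `|h t - h t0| <= `|r0| * (eps / (2 * (`|r0| + 1))).
      by rewrite ler_wpM2l // ltW.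
    have b4 : `|r0| * (eps / (2 * (`|r0| + 1))) <= (`|r0| + 1) * (eps / (2 * (`|r0| + 1))).
      by rewrite ler_wpM2r ?(ltW e1) // lerDl.
    have half (x : R) : 0 <= x -> (x + 1) * (eps / (2 * (x + 1))) = eps / 2.
      by move=> x0; field; rewrite lt0r_neq0 // ltr_wpDl.
    rewrite half // in b4; rewrite mulrC [X in _ < X]mulrC half // in b2.
    by move: b1 b2; rewrite [(_ + 1) * _]mulrC; lra.
  have [d d0 Hd] := prod_near _ (continuous_dirx t0).
  have [d' d0' Hd'] := prod_near _ (continuous_diry t0).
  exists (Num.min d d'); first by rewrite lt_min d0.
  move=> t; set m := Num.min _ _ => /andP[tm1 tm2] r rr.
  have md : m <= d by rewrite ge_min lexx.
  have md' : m <= d' by rewrite ge_min lexx orbT.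
  rewrite X0E Y0E; split; [apply: Hd|apply: Hd']; try by apply/andP; split; lra.
    exact: lt_le_trans rr md.
  exact: lt_le_trans rr md'.
(* The line of parameter [t0] may pass through P1 or P2. A nearby [t1] avoids this and supplies one
   [eta] for all slopes close to it. *)
have gu : generic (fun t => cross u1 u2 t != 0).
  apply: generic_cross; rewrite -negb_and; apply: contraNN uv => /andP[/eqP -> /eqP ->].
  by rewrite !mul0r subrr.
have gv : generic (fun t => cross v1 v2 t != 0).
  apply: generic_cross; rewrite -negb_and; apply: contraNN uv => /andP[/eqP -> /eqP ->].
  by rewrite !mulr0 subrr.
have [|t1 [/andP[t1a t1b] [cu0 cv0]]] := generic_rational _ (t0 - d1) (t0 + d1) _ (generic_and _ _ gu gv).
  by lra.
move: (ratr t1 : R) => {}t1 in t1a t1b cu0 cv0 *.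
have a1 : 0 < a - al t1 ^+ 2 by rewrite lagrange mulr_gt0 // lt_def sqr_ge0 sqrf_eq0 cu0.
have c1 : 0 < c - be t1 ^+ 2 by rewrite lagrange mulr_gt0 // lt_def sqr_ge0 sqrf_eq0 cv0.
pose eta := Num.min (a - al t1 ^+ 2) (c - be t1 ^+ 2) / 2.
have eta0 : 0 < eta by rewrite divr_gt0 // lt_min a1.
have eta1 : eta < a - al t1 ^+ 2.
  have : Num.min (a - al t1 ^+ 2) (c - be t1 ^+ 2) <= a - al t1 ^+ 2 by rewrite ge_min lexx.
  by move: eta0; rewrite /eta; lra.
have eta2 : eta < c - be t1 ^+ 2.
  have : Num.min (a - al t1 ^+ 2) (c - be t1 ^+ 2) <= c - be t1 ^+ 2 by rewrite ge_min lexx orbT.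
  by move: eta0; rewrite /eta; lra.
have [d2 d20 Hd2] : exists2 d, 0 < d & forall t, t1 - d < t < t1 + d ->
    (0 < a - al t ^+ 2 - eta /\ 0 < c - be t ^+ 2 - eta) /\
    (0 < t - (t0 - d1) /\ 0 < t0 + d1 - t).
  apply: near_interval; near=> t; split; split.
  - near: t; apply: (continuous_gt0_near (fun t => a - al t ^+ 2 - eta)).
      by apply: continuousB => //; apply: continuousB => //; apply: sqr_cont; exact: continuous_dot.
    by rewrite subr_gt0.
  - near: t; apply: (continuous_gt0_near (fun t => c - be t ^+ 2 - eta)).
      by apply: continuousB => //; apply: continuousB => //; apply: sqr_cont; exact: continuous_dot.
    by rewrite subr_gt0.
  - near: t; apply: (continuous_gt0_near (fun t => t - (t0 - d1))); last lra.
    by apply: continuousB => //; exact: cvg_id.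
  - near: t; apply: (continuous_gt0_near (fun t => t0 + d1 - t)); last lra.
    by apply: continuousB => //; exact: cvg_id.
pose r1 := r0 - d1; pose r2 := r0 + d1.
have [m0 M0] := angle_bounds_gt0 eta (al t1) (be t1) a c eta0 (ltW eta1) (ltW eta2).
have W0 : 0 < (atan r2 - atan r1) / angle_bound_up a c.
  by rewrite divr_gt0 // subr_gt0 lt_atan // /r1 /r2; lra.
set W := (_ / _) in W0.
(* N depends on [t1] and the interval only; t is chosen afterwards, off the finitely many slopes
   whose orbit might stop within N steps. *)
pose N := Num.truncn (pi / angle_bound_low eta a c / W).
have HN : pi / angle_bound_low eta a c < N.+1%:R * W.
  rewrite -ltr_pdivrMr //.
  have /truncn_itv/andP[_ h] : 0 <= pi / angle_bound_low eta a c / W.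
    by rewrite divr_ge0 1?ltW // divr_gt0 // pi_gt0.
  exact: h.
have [|t [tt [[del0 kal0] gN]]] := generic_rational _ (t1 - d2) (t1 + d2) _
  (generic_and _ _ generic_line (generic_finite_orb_line N)); first lra.
have [[ha hc] [ta tb]] := Hd2 _ tt.
have rt : rational (ratr t : R) by exact: rational_ratr.
move: (ratr t : R) rt => {}t rt in tt del0 kal0 gN ha hc ta tb *.
have ha' : eta <= a - al t ^+ 2 by lra.
have hc' : eta <= c - be t ^+ 2 by lra.
have [|n [gn rn]] := line_hits eta (al t) (be t) a c N r1 r2 eta0 ha' hc' del0 kal0 gN _ HN.
  by rewrite /r1 /r2; lra.
have rex : rational (ex t) by rewrite /ex /dirx; rational_tac.
have rey : rational (ey t) by rewrite /ey /diry; rational_tac.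
have ral : rational (al t) by rewrite /al /dot /dir_dot -/(ex t) -/(ey t); rational_tac.
have rbe : rational (be t) by rewrite /be /dot /dir_dot -/(ex t) -/(ey t); rational_tac.
have ra : rational a by rewrite /a; rational_tac.
have rc : rational c by rewrite /c; rational_tac.
have ha2 : al t ^+ 2 < a by lra.
have hc2 : be t ^+ 2 < c by lra.
have [[sO1 sO2] _] := orb_on _ _ _ _ ha2 hc2 del0 kal0 n gn.
have [q1 q2 q3] := rational_orb _ (al t) (be t) a c n ral rbe ra rc.
move: (orb (al t) (be t) a c n) => [[r s] w] /= in rn sO1 sO2 q1 q2 q3 *.
exists (r * ex t), (r * ey t).
have [||hX hY] := Hd1 t _ r; first by apply/andP; split; lra.
  by rewrite ltr_norml; move: rn; rewrite /r1 /r2 => /andP[? ?]; apply/andP; split; lra.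
split => //; try exact: rationalM.
exists r, s, w; split => //; split.
- transitivity (r ^+ 2 * (ex t ^+ 2 + D * ey t ^+ 2)); first by ring.
  by rewrite dir_norm mulr1.
- rewrite sO1 /sqdist /al /dot /dir_dot -/(ex t) -/(ey t) /a.
  transitivity (r ^+ 2 * (ex t ^+ 2 + D * ey t ^+ 2) - 2 * (u1 * ex t + D * (u2 * ey t)) * r +
    (u1 ^+ 2 + D * u2 ^+ 2)); first by ring.
  by rewrite dir_norm mulr1.
- rewrite sO2 /sqdist /be /dot /dir_dot -/(ex t) -/(ey t) /c.
  transitivity (r ^+ 2 * (ex t ^+ 2 + D * ey t ^+ 2) - 2 * (v1 * ex t + D * (v2 * ey t)) * r +
    (v1 ^+ 2 + D * v2 ^+ 2)); first by ring.
  by rewrite dir_norm mulr1.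
Unshelve. all: by end_near. Qed.

End TwoVectors.
End Plane.

(** * The triangle *)

(** A column of [cokermx M] is a functional killing the rows chosen so far; a vector of V on which
    it is nonzero is independent of them. *)
Lemma extend_row_free (F : fieldType) n k (V : set ('I_n -> F)) :
  (forall w : 'I_n -> F, (exists i, w i != 0) ->
     exists2 s, V s & \sum_i s i * w i != 0) ->
  (k <= n)%N ->
  exists M : 'M[F]_(k, n), row_free M /\ forall i, V (M i).
Proof.
move=> Vw; elim: k => [_|k IH kn].
  by exists 0; split; [rewrite /row_free mxrank0|case].
have [M [Mfree MV]] := IH (ltnW kn).
have : cokermx M != 0.
  by rewrite -mxrank_eq0 mxrank_coker (eqP Mfree) -lt0n subn_gt0.
move=> /matrix0Pn[i [j wij]].
have Mw : M *m col j (cokermx M) = 0 by rewrite colE mulmxA mulmx_coker mul0mx.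
have [|s Vs sw] := Vw (fun i => cokermx M i j); first by exists i.
pose sr : 'rV[F]_n := \row_l s l.
exists (col_mx sr M : 'M[F]_(1 + k, n)); split.
  apply: (@inj_row_free F (1 + k) n) => v.
  rewrite -[v in X in X -> _]hsubmxK mul_row_col => v0; rewrite -[v]hsubmxK.
  have l0 : lsubmx (v : 'rV[F]_(1 + k)) = 0.
    have := congr1 (mulmx ^~ (col j (cokermx M))) v0.
    rewrite mulmxDl mul0mx -!mulmxA Mw mulmx0 addr0 => e.
    apply/rowP => x; rewrite !ord1; move/matrixP: e => /(_ 0 0).
    rewrite !mxE big_ord1 !mxE => /eqP; rewrite mulf_eq0 => /orP[/eqP ->//|].
    rewrite (eq_bigr (fun l => s l * cokermx M l j)) ?(negPf sw) // => l _.
    by congr (_ * _); rewrite mxE.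
  move: v0; rewrite l0 mul0mx add0r => /eqP.
  by rewrite mulmx_free_eq0 // => /eqP ->; rewrite row_mx0.
move=> x; have [y ->|y ->] := split_ordP (x : 'I_(1 + k)).
  suff -> : (col_mx sr M : 'M[F]_(1 + k, n)) (lshift k y) = s by [].
  by apply/funext => l; rewrite col_mxEu mxE.
suff -> : (col_mx sr M : 'M[F]_(1 + k, n)) (rshift 1 y) = M y by [].
by apply/funext => l; rewrite col_mxEd.
Qed.

(** The second hypothesis says that V spans, so n independent vectors of V give an invertible
    rational system for X with rational right-hand side. *)
Lemma rational_interpolation (R : realType) n (X : 'I_n -> R) (V : set ('I_n -> rat)) :
  (forall s, V s -> rational (\sum_i ratr (s i) * X i)) ->
  (forall w : 'I_n -> rat, (exists i, w i != 0) ->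
     exists2 s, V s & \sum_i s i * w i != 0) ->
  forall i, rational (X i).
Proof.
move=> VX Vw i.
have [M [Mfree MV]] := extend_row_free _ _ n V Vw (leqnn n).
have /(_ _)/cid-/all_sig[y yE] : forall l, exists q : rat, ratr q = \sum_j ratr (M l j) * X j :> R.
  by move=> l; have [q _ <-] := VX _ (MV l); exists q.
pose XX : 'cV[R]_n := \col_j X j.
pose Y : 'cV[rat]_n := \col_j y j.
have MX : map_mx ratr M *m XX = map_mx ratr Y.
  by apply/colP => l; rewrite !mxE yE; apply: eq_bigr => j _; rewrite !mxE.
have Mu : M \in unitmx by rewrite -row_free_unit.
have XE : XX = map_mx ratr (invmx M *m Y).
  rewrite map_mxM -MX map_invmx mulKmx //.
  by rewrite map_unitmx.
exists ((invmx M *m Y) i 0) => //.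
by have /colP/(_ i) := XE; rewrite !mxE => ->.
Qed.

Section Coordinates.
Context {R : realType}.
Implicit Types (P Q u v w z : 'rV[R]_2) (s t : R).

Definition dotv v w : R := v 0 0 * w 0 0 + v 0 1 * w 0 1.
Definition crossv v w : R := v 0 0 * w 0 1 - v 0 1 * w 0 0.

Lemma row2P v w : v 0 0 = w 0 0 -> v 0 1 = w 0 1 -> v = w.
Proof.
move=> h0 h1; apply/rowP => -[[|[|//]] i2].
  by have -> : Ordinal i2 = 0 by exact: val_inj.
by have -> : Ordinal i2 = 1 by exact: val_inj.
Qed.

Lemma euclid_norm_sqr v : euclid_norm v ^+ 2 = dotv v v.
Proof.
rewrite /euclid_norm sqr_sqrtr; last by apply: sumr_ge0 => i _; exact: sqr_ge0.
rewrite big_ord_recl big_ord1 /dotv -!expr2; congr (_ + v _ _ ^+ 2).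
exact: val_inj.
Qed.

Lemma euclid_dist_sqr P Q : euclid_dist P Q ^+ 2 = dotv (Q - P) (Q - P).
Proof. exact: euclid_norm_sqr. Qed.

Lemma euclid_dist_rational P Q r : rational r -> dotv (Q - P) (Q - P) = r ^+ 2 ->
  rational (euclid_dist P Q).
Proof.
move=> rr e; have -> : euclid_dist P Q = `|r|; last exact: rational_norm.
have d0 : 0 <= euclid_dist P Q by exact: sqrtr_ge0.
by rewrite -[LHS]ger0_norm // -!sqrtr_sqr euclid_dist_sqr e.
Qed.

Lemma nonaligned_cross (P1 P2 P3 : 'rV[R]_2) : ~ aligned P1 P2 P3 ->
  crossv (P3 - P1) (P3 - P2) != 0.
Proof.
move=> na; apply/eqP => c0; apply: na.
set u := P3 - P1 in c0; set v := P3 - P2 in c0.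
have P1E : P1 = P3 - u by rewrite /u subKr.
have P2E : P2 = P3 - v by rewrite /v subKr.
have mk d s1 s2 : d != 0 -> u = s1 *: d -> v = s2 *: d -> aligned P1 P2 P3.
  move=> d0 uE vE; exists P3, d; split => // Q [[]|] ->.
  - by exists (- s1) => //; rewrite scaleNr -uE -P1E.
  - by exists (- s2) => //; rewrite scaleNr -vE -P2E.
  - by exists 0 => //; rewrite scale0r addr0.
have nz w : w != 0 -> dotv w w != 0.
  apply: contraNN => /eqP; rewrite /dotv -!expr2 => /eqP.
  rewrite paddr_eq0 ?sqr_ge0 // !sqrf_eq0 => /andP[/eqP h1 /eqP h2].
  by apply/eqP/row2P; rewrite mxE.
have [u0|u0] := eqVneq u 0.
  have [v0|v0] := eqVneq v 0.
    apply: (mk (const_mx 1) 0 0); rewrite ?scale0r //.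
    by apply/eqP => /rowP /(_ 0); rewrite !mxE => /eqP; rewrite oner_eq0.
  by apply: (mk v 0 1); rewrite ?scale0r ?scale1r.
apply: (mk u 1 (dotv u v / dotv u u)); rewrite ?scale1r //.
have uu := nz _ u0.
have cross0 : u 0 0 * v 0 1 = u 0 1 * v 0 0 by apply/eqP; rewrite -subr_eq0 -/(crossv u v) c0.
apply: row2P; rewrite [in RHS]mxE; apply: (mulIf uu); rewrite mulrAC divfK // /dotv.
  transitivity (v 0 0 * u 0 0 * u 0 0 + (u 0 1 * v 0 0) * u 0 1); first by ring.
  by rewrite -cross0; ring.
transitivity (v 0 1 * u 0 1 * u 0 1 + (u 0 0 * v 0 1) * u 0 0); first by ring.
by rewrite cross0; ring.
Qed.



Lemma dotvC v w : dotv v w = dotv w v.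
Proof. by rewrite /dotv; ring. Qed.

Lemma dotv_lin s t u v w :
  dotv (s *: u + t *: v) w = s * dotv u w + t * dotv v w.
Proof. by rewrite /dotv !mxE; ring. Qed.

(** Cramer's rule for the Gram matrix, of determinant [crossv u v ^+ 2]: coordinates are rational
    once the scalar products are. *)
Lemma gram_decomposition u v z : crossv u v != 0 ->
  ((dotv z u * dotv v v - dotv z v * dotv u v) / crossv u v ^+ 2) *: u +
  ((dotv z v * dotv u u - dotv z u * dotv u v) / crossv u v ^+ 2) *: v = z.
Proof.
by rewrite /dotv /crossv => c0; apply: row2P; rewrite !mxE; field.
Qed.

End Coordinates.

(** * The three conditions in terms of the Gram matrix of the sides *)

Section Triangle.
Context {R : realType}.
Variables (P1 P2 P3 : 'rV[R]_2).
Hypothesis nonaligned : ~ aligned P1 P2 P3.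
Let u := P3 - P1.
Let v := P3 - P2.
Let A := dotv u u.
Let B := dotv u v.
Let C := dotv v v.
Let Dl := crossv u v.
Let q (x y : R) : R := euclid_norm (x *: u + y *: v) ^+ 2.

Definition rational_distances : set 'rV[R]_2 :=
  [set Q | [/\ rational (euclid_dist Q P1), rational (euclid_dist Q P2)
    & rational (euclid_dist Q P3)]].

Lemma cross_neq0 : Dl != 0.
Proof. exact: nonaligned_cross. Qed.

Lemma gramE : A * C - B ^+ 2 = Dl ^+ 2.
Proof. by rewrite /A /B /C /Dl /dotv /crossv; ring. Qed.

Lemma qE x y : q x y = A * x ^+ 2 + 2 * B * (x * y) + C * y ^+ 2.
Proof. by rewrite /q euclid_norm_sqr /A /B /C /dotv !mxE -/u -/v; ring. Qed.

Lemma rational_coefficientsP :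
  rational_coefficients q <-> [/\ rational A, rational B & rational C].
Proof.
split=> [[a [b [c H]]]|[[a _ aE] [b _ bE] [c _ cE]]].
  have AE : A = ratr a by have := H 1 0; rewrite qE; lra.
  have CE : C = ratr c by have := H 0 1; rewrite qE; lra.
  have BE : B = ratr b / 2 by have := H 1 1; rewrite qE AE CE; lra.
  by rewrite AE BE CE; split; rational_tac.
exists a, (2 * b), c => x y.
by rewrite qE rmorphM /= rmorph_nat aE bE cE.
Qed.

Lemma dense_of_form : rational_coefficients q -> represents_square q ->
  dense rational_distances.
Proof.
move=> /rational_coefficientsP[rA rB rC] [x0 [y0 [xy0 [r0 qr]]]].
have Dl0 := cross_neq0.
(* The form is positive definite, so the represented square is nonzero and division by [r0] gives a
   unit vector. *)
have r00 : ratr r0 != 0 :> R.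
  apply/eqP => r00; apply: xy0.
  have [e1 e2] : (x0 = 0 /\ y0 = 0).
    move: qr; rewrite r00 expr0n /= /q euclid_norm_sqr /dotv -!expr2 => /eqP.
    rewrite paddr_eq0 ?sqr_ge0 // !sqrf_eq0 !mxE => /andP[/eqP h1 /eqP h2].
    have hx : ratr x0 * Dl = 0.
      transitivity ((ratr x0 * u 0 0 + ratr y0 * v 0 0) * v 0 1 -
        (ratr x0 * u 0 1 + ratr y0 * v 0 1) * v 0 0); first by rewrite /Dl /crossv; ring.
      by rewrite !mxE h1 h2 !mul0r subrr.
    have hy : ratr y0 * Dl = 0.
      transitivity ((ratr x0 * u 0 1 + ratr y0 * v 0 1) * u 0 0 -
        (ratr x0 * u 0 0 + ratr y0 * v 0 0) * u 0 1); first by rewrite /Dl /crossv; ring.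
      by rewrite !mxE h1 h2 !mul0r subrr.
    move/eqP: hx; rewrite mulf_eq0 (negPf Dl0) orbF fmorph_eq0 => /eqP ->.
    by move/eqP: hy; rewrite mulf_eq0 (negPf Dl0) orbF fmorph_eq0 => /eqP ->.
  by rewrite e1 e2.
pose x : R := ratr x0 / ratr r0; pose y : R := ratr y0 / ratr r0.
have rx : rational x by rewrite /x; rational_tac.
have ry : rational y by rewrite /y; rational_tac.
have q1 : A * x ^+ 2 + 2 * B * (x * y) + C * y ^+ 2 = 1.
  transitivity (q (ratr x0) (ratr y0) / ratr r0 ^+ 2); last by rewrite qr divff // sqrf_eq0.
  by rewrite qE /x /y; field.
(* The orthogonal basis is w and the quarter turn of w scaled by Dl, which is
   again a rational combination of u and v. *)
pose w1 := x * u 0 0 + y * v 0 0; pose w2 := x * u 0 1 + y * v 0 1.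
have w11 : w1 ^+ 2 + w2 ^+ 2 = 1.
  by rewrite -q1 /w1 /w2 /A /B /C /dotv; ring.
have D0 : 0 < Dl ^+ 2 by rewrite lt_def sqr_ge0 sqrf_eq0 Dl0.
have uw1 : u 0 0 = (x * A + y * B) * w1 + y * Dl * w2.
  by rewrite -[LHS]mulr1 -w11 /w1 /w2 /A /B /Dl /dotv /crossv; ring.
have uw2 : u 0 1 = (x * A + y * B) * w2 - y * Dl * w1.
  by rewrite -[LHS]mulr1 -w11 /w1 /w2 /A /B /Dl /dotv /crossv; ring.
have vw1 : v 0 0 = (x * B + y * C) * w1 - x * Dl * w2.
  by rewrite -[LHS]mulr1 -w11 /w1 /w2 /B /C /Dl /dotv /crossv; ring.
have vw2 : v 0 1 = (x * B + y * C) * w2 + x * Dl * w1.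
  by rewrite -[LHS]mulr1 -w11 /w1 /w2 /B /C /Dl /dotv /crossv; ring.
move=> O [Q0 OQ0] openO.
have [e e0 He] : exists2 e, 0 < e & forall Q : 'rV[R]_2, (forall i, `|Q0 0 i - Q 0 i| < e) -> O Q.
  have : nbhs Q0 O by exact: open_nbhs_nbhs.
  move=> /nbhs_ballP[e /= e0 He]; exists e => // Q HQ; apply: He.
  by split=> // i j; rewrite [i]ord1; exact: HQ.
pose z1 := Q0 0 0 - P3 0 0; pose z2 := Q0 0 1 - P3 0 1.
(* In the plane the error on Y is multiplied by [Dl], the error on X by a unit vector only. *)
pose bnd := 1 + `|Dl|.
have bnd0 : 0 < bnd by rewrite ltr_pwDl.
have [|||||||X [Y [rX rY Xe Ye [r [s [t [[rr rs rt] [h1 h2 h3]]]]]]]] :=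
  rational_points_dense (Dl ^+ 2) D0 (- (x * A + y * B)) y (- (x * B + y * C)) (- x)
    _ _ _ _ _ _ (z1 * w1 + z2 * w2) ((z2 * w1 - z1 * w2) / Dl) (e / (2 * bnd)) _.
- rewrite (_ : _ - _ = 1) ?oner_eq0 // -q1; ring.
(* [Dl] may be irrational, but its square is the Gram determinant. *)
- by rewrite -gramE; rational_tac.
- by rational_tac.
- by [].
- by rational_tac.
- by rational_tac.
- by rewrite divr_gt0 // mulr_gt0.
pose Q : 'rV[R]_2 := \row_i (P3 0 i + (if i == 0 then X * w1 - Y * Dl * w2 else X * w2 + Y * Dl * w1)).
have Q0E : Q 0 0 = P3 0 0 + (X * w1 - Y * Dl * w2) by rewrite mxE eqxx.
have Q1E : Q 0 1 = P3 0 1 + (X * w2 + Y * Dl * w1) by rewrite mxE.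
clearbody Q.
have distP (P : 'rV[R]_2) a b k : rational k ->
    P3 0 0 - P 0 0 = - (a * w1 - b * Dl * w2) -> P3 0 1 - P 0 1 = - (a * w2 + b * Dl * w1) ->
    (X - a) ^+ 2 + Dl ^+ 2 * (Y - b) ^+ 2 = k ^+ 2 -> rational (euclid_dist Q P).
  move=> rk e1 e2 e3; apply: (euclid_dist_rational _ _ _ rk); rewrite -e3 /dotv.
  have E i : (P - Q) 0 i = P 0 i - Q 0 i by rewrite !mxE.
  rewrite !E Q0E Q1E.
  have -> : P 0 0 = P3 0 0 + (a * w1 - b * Dl * w2) by rewrite -[X in _ + X]opprK -e1; ring.
  have -> : P 0 1 = P3 0 1 + (a * w2 + b * Dl * w1) by rewrite -[X in _ + X]opprK -e2; ring.
  rewrite -[RHS]mulr1 -w11; ring.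
exists Q; split.
  apply: He.
  have w1b : `|w1| <= 1.
    by rewrite -(@ler_pXn2r _ 2) ?nnegrE // expr1n real_normK ?num_real // -w11 lerDl sqr_ge0.
  have w2b : `|w2| <= 1.
    by rewrite -(@ler_pXn2r _ 2) ?nnegrE // expr1n real_normK ?num_real // -w11 lerDr sqr_ge0.
  have small (a b : R) : `|a| <= 1 -> `|b| <= 1 ->
      `|(X - (z1 * w1 + z2 * w2)) * a + (Y - (z2 * w1 - z1 * w2) / Dl) * Dl * b| < e.
    move=> a1 b1; apply: le_lt_trans (ler_normD _ _) _; rewrite !normrM.
    have eb : e / (2 * bnd) * bnd = e / 2 by field; exact: lt0r_neq0.
    set p := e / (2 * bnd) in Xe Ye eb.
    have p0 : 0 < p by exact: le_lt_trans Xe.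
    have k1 : `|X - (z1 * w1 + z2 * w2)| * `|a| <= p by rewrite -[p]mulr1 ler_pM // ltW.
    have k2 : `|Y - (z2 * w1 - z1 * w2) / Dl| * `|Dl| * `|b| <= p * `|Dl|.
      by rewrite -[p * _]mulr1 ler_pM ?mulr_ge0 // ler_wpM2r // ltW.
    by rewrite /bnd mulrDr mulr1 in eb; lra.
  have zE1 : z1 = (z1 * w1 + z2 * w2) * w1 - (z2 * w1 - z1 * w2) / Dl * Dl * w2.
    by rewrite divfK // -[LHS]mulr1 -w11; ring.
  have zE2 : z2 = (z1 * w1 + z2 * w2) * w2 + (z2 * w1 - z1 * w2) / Dl * Dl * w1.
    by rewrite divfK // -[LHS]mulr1 -w11; ring.
  move=> -[[|[|//]] i2].
    have -> : Ordinal i2 = 0 by exact: val_inj.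
    have := small w1 (- w2) w1b; rewrite normrN => /(_ w2b).
    rewrite distrC Q0E; congr (`|_| < e).
    have -> : Q0 0 0 = P3 0 0 + z1 by rewrite /z1; ring.
    by rewrite [in RHS]zE1; ring.
  have -> : Ordinal i2 = 1 by exact: val_inj.
  have := small w2 w1 w2b w1b.
  rewrite distrC Q1E; congr (`|_| < e).
  have -> : Q0 0 1 = P3 0 1 + z2 by rewrite /z2; ring.
  by rewrite [in RHS]zE2; ring.
split.
- apply: (distP _ _ _ _ rs _ _ h2).
    have -> : P3 0 0 - P1 0 0 = u 0 0 by rewrite !mxE.
    by rewrite uw1; ring.
  have -> : P3 0 1 - P1 0 1 = u 0 1 by rewrite !mxE.
  by rewrite uw2; ring.
- apply: (distP _ _ _ _ rt _ _ h3).
    have -> : P3 0 0 - P2 0 0 = v 0 0 by rewrite !mxE.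
    by rewrite vw1; ring.
  have -> : P3 0 1 - P2 0 1 = v 0 1 by rewrite !mxE.
  by rewrite vw2; ring.
- by apply: (distP _ 0 0 _ rr); rewrite ?subr0 //; ring.
Qed.


Lemma rational_euclid_dist_sqr P Q : rational (euclid_dist P Q) ->
  rational (dotv (Q - P) (Q - P) : R).
Proof. by rewrite -euclid_dist_sqr; exact: rationalX. Qed.

Lemma dist_expand Q : let z := Q - P3 in
  [/\ dotv (P1 - Q) (P1 - Q) = dotv z z + 2 * dotv z u + A,
      dotv (P2 - Q) (P2 - Q) = dotv z z + 2 * dotv z v + C
    & dotv (P3 - Q) (P3 - Q) = dotv z z].
Proof. by split; rewrite /A /C /u /v /dotv !mxE; ring. Qed.

(** The vector Q - P3 has rational scalar products with u and v, by differences of squared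
    distances, so it is a rational combination of them, of norm d(Q, P3). If Q = P3 it is zero, and
    the side P1P3, of length d(Q, P1), replaces it. *)
Lemma represents_of_point : [/\ rational A, rational B & rational C] ->
  (exists Q, rational_distances Q) -> represents_square q.
Proof.
move=> [rA rB rC] [Q [r1 r2 r3]].
have [e1 e2 e3] := dist_expand Q.
have [t1 t2] := (rational_euclid_dist_sqr _ _ r1, rational_euclid_dist_sqr _ _ r2).
have t3 := rational_euclid_dist_sqr _ _ r3.
move: e1 e2 e3; cbv zeta; set z := Q - P3 => e1 e2 e3.
have Dl0 := cross_neq0.
have [z0|z0] := eqVneq z 0.
  have QP3 : Q = P3 by apply/eqP; rewrite -subr_eq0 -/z z0.
  move: r1; rewrite QP3 => -[k _ kE].
  exists 1, 0; split; first by case.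
  exists k; rewrite kE euclid_dist_sqr /q rmorph1 rmorph0 scale1r scale0r addr0 euclid_norm_sqr.
  by rewrite /u /dotv !mxE; ring.
pose m := dotv z u; pose n := dotv z v.
have rm : rational m.
  have -> : m = (dotv (P1 - Q) (P1 - Q) - dotv (P3 - Q) (P3 - Q) - A) / 2.
    by rewrite e1 e3 /m; lra.
  by rational_tac.
have rn : rational n.
  have -> : n = (dotv (P2 - Q) (P2 - Q) - dotv (P3 - Q) (P3 - Q) - C) / 2.
    by rewrite e2 e3 /n; lra.
  by rational_tac.
have rD : rational (Dl ^+ 2) by rewrite -gramE; rational_tac.
have [x xE] : exists x : rat, ratr x = (m * C - n * B) / Dl ^+ 2.
  have [x _ <-] : rational ((m * C - n * B) / Dl ^+ 2) by rational_tac.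
  by exists x.
have [y yE] : exists y : rat, ratr y = (n * A - m * B) / Dl ^+ 2.
  have [y _ <-] : rational ((n * A - m * B) / Dl ^+ 2) by rational_tac.
  by exists y.
have zE : ratr x *: u + ratr y *: v = z.
  by rewrite xE yE; exact: gram_decomposition.
exists x, y; split.
  move=> [x00 y00]; move: zE; rewrite x00 y00 !rmorph0 !scale0r addr0 => /esym /eqP.
  by rewrite (negPf z0).
have [k _ kE] := r3.
by exists k; rewrite /q zE kE euclid_dist_sqr euclid_norm_sqr e3.
Qed.

(** Up to sign these are the entries of the inverse Gram matrix, whose determinant is 1 / Dl^2; so
    Dl^2 is rational. *)
Lemma gram_rational :
  [/\ rational (A / Dl ^+ 2), rational (B / Dl ^+ 2) & rational (C / Dl ^+ 2)] ->
  [/\ rational A, rational B & rational C].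
Proof.
move=> [ra rb rc].
have Dl0 := cross_neq0.
have rD : rational (Dl ^+ 2).
  have -> : Dl ^+ 2 = ((A / Dl ^+ 2) * (C / Dl ^+ 2) - (B / Dl ^+ 2) ^+ 2)^-1.
    have -> : A / Dl ^+ 2 * (C / Dl ^+ 2) - (B / Dl ^+ 2) ^+ 2 = (A * C - B ^+ 2) / (Dl ^+ 2) ^+ 2.
      by field.
    by rewrite gramE; field.
  by rational_tac.
have D20 : Dl ^+ 2 != 0 by rewrite sqrf_eq0.
by rewrite -(divfK D20 A) -(divfK D20 B) -(divfK D20 C); split; exact: rationalM.
Qed.

(* The Cayley-Menger relation between the squared distances from Q, solved for
   the squared distance to P3. *)
Lemma cayley_menger Q :
  let m := dotv (P1 - Q) (P1 - Q) - dotv (P3 - Q) (P3 - Q) in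
  let n := dotv (P2 - Q) (P2 - Q) - dotv (P3 - Q) (P3 - Q) in
  4 * Dl ^+ 2 * dotv (P3 - Q) (P3 - Q) =
  C * (m - A) ^+ 2 - 2 * B * (m - A) * (n - C) + A * (n - C) ^+ 2.
Proof.
have [-> -> ->] := dist_expand Q; cbv zeta.
move: (Q - P3) => z.
by rewrite /A /B /C /Dl /dotv /crossv; ring.
Qed.

Definition quad_monomials {F : pzRingType} (m n : F) : 6.-tuple F :=
  [tuple m ^+ 2; m * n; n ^+ 2; m; n; 1].

Lemma sum6 (F : pzRingType) (f : 'I_6 -> F) :
  \sum_i f i = f (inord 0) + f (inord 1) + f (inord 2) + f (inord 3) + f (inord 4) + f (inord 5).
Proof.
rewrite !big_ord_recr big_ord0 /= add0r.
by do ?congr (_ + _); congr f; apply: val_inj; rewrite /= inordK.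
Qed.

(** [cayley_menger] makes d(Q, P3)^2 a quadratic polynomial in m and n whose six coefficients are
    the unknowns [X]; each point of the dense set gives a rational linear equation. A nonzero
    functional killing all these equations would be a nonzero quadratic polynomial vanishing on a
    dense set. *)
Lemma dense_gram_rational : dense (rational_distances) ->
  [/\ rational A, rational B & rational C].
Proof.
move=> S_dense; apply: gram_rational.
have Dl0 := cross_neq0.
pose fm (Q : 'rV[R]_2) := dotv (P1 - Q) (P1 - Q) - dotv (P3 - Q) (P3 - Q).
pose fn (Q : 'rV[R]_2) := dotv (P2 - Q) (P2 - Q) - dotv (P3 - Q) (P3 - Q).
pose X : 6.-tuple R := [tuple C / (4 * Dl ^+ 2); - (2 * B) / (4 * Dl ^+ 2); A / (4 * Dl ^+ 2);
  2 * (B * C - A * C) / (4 * Dl ^+ 2); 2 * (A * B - A * C) / (4 * Dl ^+ 2);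
  (C * A ^+ 2 - 2 * B * A * C + A * C ^+ 2) / (4 * Dl ^+ 2)].
pose V : set ('I_6 -> rat) := [set s | exists m n Q,
  [/\ s = tnth (quad_monomials m n), rational_distances Q,
      ratr m = fm Q & ratr n = fn Q]].
have ev (s : 'I_6 -> rat) (m n : rat) (Y : 'I_6 -> R) : s = tnth (quad_monomials m n) ->
    \sum_i ratr (s i) * Y i = ratr m ^+ 2 * Y (inord 0) + ratr m * ratr n * Y (inord 1)
      + ratr n ^+ 2 * Y (inord 2) + ratr m * Y (inord 3) + ratr n * Y (inord 4) + Y (inord 5).
  move=> ->; rewrite sum6 !(tnth_nth 0) !inordK //= !rmorphXn rmorphM /= rmorph1.
  by rewrite mul1r.
have rX i : rational (tnth X i).
  apply: (rational_interpolation _ 6 (tnth X) V).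
    move=> s [m [n [Q [sE [r1 r2 r3] mE nE]]]].
    rewrite (ev _ _ _ _ sE) !(tnth_nth 0) !inordK //= mE nE.
    have cm := cayley_menger Q; rewrite -/(fm Q) -/(fn Q) in cm; cbv zeta in cm.
    set lhs := (X in rational X).
    have -> : lhs = dotv (P3 - Q) (P3 - Q).
      have D40 : 4 * Dl ^+ 2 != 0 by rewrite mulf_neq0 ?sqrf_eq0.
      apply: (mulfI D40); rewrite cm /lhs; field.
      by rewrite Dl0.
    exact: rational_euclid_dist_sqr.
  move=> w w0.
  pose W (i : nat) : R := ratr (w (inord i)).
  pose p (m n : R) := m ^+ 2 * W 0 + m * n * W 1 + n ^+ 2 * W 2 + m * W 3 + n * W 4 + W 5.
  have [m0 [n0 pmn]] : exists m n, p m n != 0.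
    apply: contrapT => np.
    have p0 m n : p m n = 0.
      by apply/eqP; apply/negPn/negP => h; apply: np; exists m, n.
    have [l] := w0; apply/negP/negPn.
    suff : ratr (w l) = 0 :> R by move=> /eqP; rewrite fmorph_eq0.
    (* These six points determine a polynomial of degree 2 in two variables. *)
    have e0 := p0 0 0; have e1 := p0 1 0; have e2 := p0 (-1) 0.
    have e3 := p0 0 1; have e4 := p0 0 (-1); have e5 := p0 1 1.
    have Wi : ratr (w l) = W l by rewrite /W inord_val.
    rewrite Wi; move: e0 e1 e2 e3 e4 e5; rewrite /p => e0 e1 e2 e3 e4 e5.
    by case: l {Wi} => [[|[|[|[|[|[|//]]]]]] i6] /=; lra.
  (* By [dist_expand], (fm, fn) are affine coordinates on the plane, so every pair of values is
     attained. *)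
  have [Q0 [Q0m Q0n]] : exists Q, fm Q = m0 /\ fn Q = n0.
    pose m1 := (m0 - A) / 2; pose n1 := (n0 - C) / 2.
    pose z := ((m1 * C - n1 * B) / Dl ^+ 2) *: u + ((n1 * A - m1 * B) / Dl ^+ 2) *: v.
    exists (P3 + z); rewrite /fm /fn.
    have [-> -> ->] := dist_expand (P3 + z); rewrite [P3 + z]addrC addrK.
    have gE : A * C - B ^+ 2 = Dl ^+ 2 := gramE.
    have zu : dotv z u = m1.
      transitivity ((m1 * C - n1 * B) / Dl ^+ 2 * A + (n1 * A - m1 * B) / Dl ^+ 2 * B).
        by rewrite /z dotv_lin (dotvC v).
      transitivity (m1 * (A * C - B ^+ 2) / Dl ^+ 2); first by field.
      by rewrite gE mulfK // sqrf_eq0.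
    have zv : dotv z v = n1.
      transitivity ((m1 * C - n1 * B) / Dl ^+ 2 * B + (n1 * A - m1 * B) / Dl ^+ 2 * C).
        by rewrite /z dotv_lin.
      transitivity (n1 * (A * C - B ^+ 2) / Dl ^+ 2); first by field.
      by rewrite gE mulfK // sqrf_eq0.
    by rewrite zu zv /m1 /n1; split; lra.
  have openO : open [set Q : 'rV[R]_2 | p (fm Q) (fn Q) != 0].
    have cc (P : 'rV[R]_2) l (Q : 'rV[R]_2) : {for Q, continuous (fun Q : 'rV[R]_2 => (P - Q) 0 l)}.
      have -> : (fun Q : 'rV[R]_2 => (P - Q) 0 l) = (fun Q => P 0 l - Q 0 l).
        by apply/funext => Q'; rewrite !mxE.
      have c1 : {for Q, continuous (fun _ : 'rV[R]_2 => P 0 l)} by exact: cst_continuous.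
      have c2 : {for Q, continuous (fun Q' : 'rV[R]_2 => Q' 0 l)} by exact: coord_continuous.
      exact: continuousB c1 c2.
    have cd (P Q : 'rV[R]_2) : {for Q, continuous (fun Q : 'rV[R]_2 => dotv (P - Q) (P - Q))}.
      exact: continuousD (continuousM (cc P 0 Q) (cc P 0 Q)) (continuousM (cc P 1 Q) (cc P 1 Q)).
    have cm (Q : 'rV[R]_2) : {for Q, continuous fm} := continuousB (cd P1 Q) (cd P3 Q).
    have cn (Q : 'rV[R]_2) : {for Q, continuous fn} := continuousB (cd P2 Q) (cd P3 Q).
    have cp (Q : 'rV[R]_2) : {for Q, continuous (fun Q : 'rV[R]_2 => p (fm Q) (fn Q))}.
      have cW l : {for Q, continuous (fun _ : 'rV[R]_2 => W l)} by exact: cst_continuous.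
      have [cmQ cnQ] := (cm Q, cn Q).
      have t0 := continuousM (continuousM cmQ cmQ) (cW 0%N).
      have t1 := continuousM (continuousM cmQ cnQ) (cW 1%N).
      have t2 := continuousM (continuousM cnQ cnQ) (cW 2%N).
      have t3 := continuousM cmQ (cW 3%N).
      have t4 := continuousM cnQ (cW 4%N).
      exact: continuousD (continuousD (continuousD (continuousD (continuousD t0 t1) t2) t3) t4) (cW 5%N).
    have := @open_comp _ _ (fun Q : 'rV[R]_2 => p (fm Q) (fn Q)) [set x | x != 0].
    by apply; [move=> Q _; exact: cp|exact: open_neq].
  have [|Q [pQ SQ]] := S_dense [set Q : 'rV[R]_2 | p (fm Q) (fn Q) != 0] _ openO.
    by exists Q0; rewrite /= Q0m Q0n.
  have [r1 r2 r3] := SQ.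
  have [m _ mE] : rational (fm Q).
    by apply: rationalB; exact: rational_euclid_dist_sqr.
  have [n _ nE] : rational (fn Q).
    by apply: rationalB; exact: rational_euclid_dist_sqr.
  exists (tnth (quad_monomials m n)); first by exists m, n, Q.
  suff : ratr (\sum_i tnth (quad_monomials m n) i * w i) != 0 :> R by rewrite fmorph_eq0.
  rewrite rmorph_sum /=.
  rewrite (eq_bigr (fun i => ratr (tnth (quad_monomials m n) i) * ratr (w i))); last first.
    by move=> l _; rewrite rmorphM.
  by rewrite (ev _ m n (fun i => ratr (w i)) erefl) mE nE.
have four : rational (4 : R) by exact: rational_nat.
have D20 : Dl ^+ 2 != 0 by rewrite sqrf_eq0.
split.
- have -> : A / Dl ^+ 2 = 4 * (A / (4 * Dl ^+ 2)) by field.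
  by apply: rationalM => //; have := rX (inord 2); rewrite (tnth_nth 0) inordK.
- have -> : B / Dl ^+ 2 = - 2 * (- (2 * B) / (4 * Dl ^+ 2)) by field.
  apply: rationalM; first by rational_tac.
  by have := rX (inord 1); rewrite (tnth_nth 0) inordK.
- have -> : C / Dl ^+ 2 = 4 * (C / (4 * Dl ^+ 2)) by field.
  by apply: rationalM => //; have := rX (inord 0); rewrite (tnth_nth 0) inordK.
Qed.

Lemma gram_of_distances :
  (forall P Q, [set P1; P2; P3] P -> [set P1; P2; P3] Q -> rational (euclid_dist P Q ^+ 2)) <->
  [/\ rational A, rational B & rational C].
Proof.
split=> [H|[rA rB rC]].
  have h1 := H P1 P3 ltac:(by left; left) ltac:(by right).
  have h2 := H P2 P3 ltac:(by left; right) ltac:(by right).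
  have h3 := H P1 P2 ltac:(by left; left) ltac:(by left; right).
  rewrite !euclid_dist_sqr -/u -/v -/A -/C in h1 h2 h3.
  have BE : B = (A + C - dotv (P2 - P1) (P2 - P1)) / 2.
    by rewrite /A /B /C /u /v /dotv !mxE; field.
  by split => //; rewrite BE; rational_tac.
have d0 (P : 'rV[R]_2) : dotv (P - P) (P - P) = 0 by rewrite subrr /dotv !mxE mul0r addr0.
have dC (P Q : 'rV[R]_2) : dotv (P - Q) (P - Q) = dotv (Q - P) (Q - P).
  by rewrite /dotv !mxE; ring.
have r12 : rational (dotv (P2 - P1) (P2 - P1)).
  have -> : dotv (P2 - P1) (P2 - P1) = A - 2 * B + C.
    by rewrite /A /B /C /u /v /dotv !mxE; ring.
  by rational_tac.
have r0 : rational (0 : R) by exact: (rational_nat 0).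
by move=> P Q [[]|] -> [[]|] ->; rewrite euclid_dist_sqr ?d0 // dC.
Qed.

End Triangle.


Theorem theorem1p1 (R : realType) (P1 P2 P3 : 'rV[R]_2)
    (nonaligned : ~ aligned P1 P2 P3) :
  let q (x y : R) : R := euclid_norm (x *: (P3 - P1) + y *: (P3 - P2)) ^+ 2 in
  [<->
    dense [set Q : 'rV[R]_2 |
      [/\ rational (euclid_dist Q P1), rational (euclid_dist Q P2)
        & rational (euclid_dist Q P3)]];
    rational_coefficients q /\ represents_square q;
    (forall A B : 'rV[R]_2, [set P1; P2; P3] A -> [set P1; P2; P3] B ->
      rational (euclid_dist A B ^+ 2)) /\
    (exists Q : 'rV[R]_2,
      [/\ rational (euclid_dist Q P1), rational (euclid_dist Q P2)
        & rational (euclid_dist Q P3)])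
  ].
Proof.
move=> q.
have dense_point : dense (rational_distances P1 P2 P3) ->
    exists Q, rational_distances P1 P2 P3 Q.
  move=> /(_ setT) []; [by exists 0|exact: openT|by move=> Q [_ SQ]; exists Q].
tfae.
- move=> S_dense; have rG := dense_gram_rational P1 P2 P3 nonaligned S_dense.
  split; first by apply/rational_coefficientsP.
  exact: represents_of_point nonaligned rG (dense_point S_dense).
- move=> [rq sq]; split.
    by apply/gram_of_distances/rational_coefficientsP.
  by apply: dense_point; exact: dense_of_form.
- move=> [/gram_of_distances rG exQ].
  apply: (dense_of_form _ _ _ nonaligned); first by apply/rational_coefficientsP.
  exact: represents_of_point nonaligned rG exQ.
Qed.
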